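(* Let $\mathcal H_1,\mathcal H_2$ be Hilbert spaces. (i) If $\dim\mathcal H_1<\infty$, then every $\theta\in B(\mathcal H_1,F^2(H_n)\otimes\mathcal H_2)$ factors as $\theta=M_\chi\psi$, where $\psi\in B(\mathcal H_1,F^2(H_n)\otimes\mathcal H_3)$ is outer and $M_\chi\in R_n^\infty\bar\otimes B(\mathcal H_3,\mathcal H_2)$ is inner, for some Hilbert space $\mathcal H_3$; the factorization is unique up to a unitary constant: if also $\theta=M_{\chi'}\psi'$ with $\psi'\in B(\mathcal H_1,F^2(H_n)\otimes\mathcal H_3')$ outer and $M_{\chi'}$ inner, then there is a unitary $U:\mathcal H_3\to\mathcal H_3'$ with $\psi'=(I\otimes U)\psi$ and $M_\chi=M_{\chi'}(I\otimes U)$. (ii) If $\mathcal H_1$ is arbitrary and $M_\theta\in R_n^\infty\bar\otimes B(\mathcal H_1,\mathcal H_2)$, then there exist a Hilbert space $\mathcal H_3$, an outer $M_\psi\in R_n^\infty\bar\otimes B(\mathcal H_1,\mathcal H_3)$ and an inner $M_\chi\in R_n^\infty\bar\otimes B(\mathcal H_3,\mathcal H_2)$ with $M_\theta=M_\chi M_\psi$; this factorization is unique up to a unitary constant in the same sense as in (i).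
   Context: Full Fock space $F^2(H_n)$ with basis $e_\alpha$, $\alpha\in\mathbb F_n^+$; $S_i\psi=e_i\otimes\psi$, $S_\alpha$ products. $R_n^\infty\bar\otimes B(\mathcal K,\mathcal K')$ denotes the set of multi-analytic operators, i.e. bounded $M:F^2(H_n)\otimes\mathcal K\to F^2(H_n)\otimes\mathcal K'$ with $M(S_i\otimes I_{\mathcal K})=(S_i\otimes I_{\mathcal K'})M$ for all $i$. $M$ is inner if it is an isometry. A bounded operator $\psi\in B(\mathcal H,F^2(H_n)\otimes\mathcal K)$ is outer if $\bigvee_{\alpha\in\mathbb F_n^+}(S_\alpha\otimes I_{\mathcal K})\psi\mathcal H=F^2(H_n)\otimes\mathcal K$; a multi-analytic $M_\psi$ is outer if its symbol $\psi:h\mapsto M_\psi(1\otimes h)$ is outer. $M_\chi\psi$ denotes composition. *)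

(* Defs.v *)
From HB Require Import structures.
From mathcomp Require Import all_boot all_order all_algebra.
From mathcomp Require Import complex.
From mathcomp Require Import all_classical all_reals.
From mathcomp Require Import constructive_ereal ereal esum.
Set Implicit Arguments. Unset Strict Implicit. Unset Printing Implicit Defensive.
Import Order.TTheory GRing.Theory Num.Theory.
Local Open Scope ring_scope.

Record hilbert (R : realType) := Hilbert {
  hspace :> lmodType R[i];
  hdot : hspace -> hspace -> R[i];
  hdot_linl : forall (a : R[i]) (x y z : hspace),
      hdot (a *: x + y) z = a * hdot x z + hdot y z;
  hdot_conj : forall x y : hspace, hdot y x = (hdot x y)^*;
  hdot_pos : forall x : hspace, x != 0 -> 0 < hdot x x;
  hcomplete : forall u : nat -> hspace,
      (forall e : R, 0 < e -> exists N : nat, forall m k : nat,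
          (N <= m)%N -> (N <= k)%N ->
          Num.sqrt (complex.Re (hdot (u m - u k) (u m - u k))) < e) ->
      exists l : hspace, forall e : R, 0 < e -> exists N : nat,
          forall m : nat, (N <= m)%N ->
          Num.sqrt (complex.Re (hdot (u m - l) (u m - l))) < e
}.

Section Fock.
Variable R : realType.

Definition hnorm (H : hilbert R) (x : H) : R :=
  Num.sqrt (complex.Re (hdot x x)).

Definition linear_map (H K : hilbert R) (f : H -> K) :=
  forall (a : R[i]) (x y : H), f (a *: x + y) = a *: f x + f y.

Definition unitary (H K : hilbert R) (U : H -> K) :=
  [/\ linear_map U, forall x y : H, hdot (U x) (U y) = hdot x y
    & forall y : K, exists x : H, U x = y].

Definition findim (H : hilbert R) :=
  exists s : seq H, forall x : H, exists c : nat -> R[i],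
    x = \sum_(i < size s) c i *: nth 0 s i.

Variable n : nat.

(* Free monoid F_n^+ on n generators: words = seq 'I_n (empty word = unit).
   F^2(H_n) (x) K is modelled as the square-summable K-valued families
   indexed by words: f corresponds to sum_alpha e_alpha (x) f alpha. *)
Definition word := seq 'I_n.
Definition fock (K : hilbert R) := word -> K.

Definition fock_sqsum (K : hilbert R) (f : fock K) : \bar R :=
  \esum_(w in [set: word]) ((hnorm (f w)) ^+ 2)%:E.

Definition l2 (K : hilbert R) (f : fock K) : Prop :=
  (fock_sqsum f < +oo)%E.

Definition fnorm (K : hilbert R) (f : fock K) : R :=
  Num.sqrt (fine (fock_sqsum f)).

Definition fadd (K : hilbert R) (f g : fock K) : fock K := fun w => f w + g w.
Definition fopp (K : hilbert R) (f : fock K) : fock K := fun w => - f w.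
Definition fscale (K : hilbert R) (a : R[i]) (f : fock K) : fock K :=
  fun w => a *: f w.

(* S_i (x) I_K : e_alpha (x) h |-> e_{i alpha} (x) h *)
Definition shift (K : hilbert R) (i : 'I_n) (f : fock K) : fock K :=
  fun w => match w with
           | j :: w' => if j == i then f w' else 0
           | [::] => 0
           end.

Definition shiftw (K : hilbert R) (alpha : word) : fock K -> fock K :=
  foldr (fun i g => shift i \o g) id alpha.

Definition vac (K : hilbert R) (h : K) : fock K :=
  fun w => if w == [::] then h else 0.

Definition ampl (K K' : hilbert R) (U : K -> K') (f : fock K) : fock K' :=
  fun w => U (f w).

Definition bounded_to_fock (H K : hilbert R) (psi : H -> fock K) :=
  [/\ forall (a : R[i]) (x y : H),
        psi (a *: x + y) = fadd (fscale a (psi x)) (psi y),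
      forall x : H, l2 (psi x)
    & exists C : R, forall x : H, fnorm (psi x) <= C * hnorm x].

Definition bounded_fock (K K' : hilbert R) (M : fock K -> fock K') :=
  [/\ forall (a : R[i]) (f g : fock K), l2 f -> l2 g ->
        M (fadd (fscale a f) g) = fadd (fscale a (M f)) (M g),
      forall f : fock K, l2 f -> l2 (M f)
    & exists C : R, forall f : fock K, l2 f -> fnorm (M f) <= C * fnorm f].

(* M in R_n^infty \bar(x) B(K, K') : bounded and commuting with S_i (x) I *)
Definition multi_analytic (K K' : hilbert R) (M : fock K -> fock K') :=
  bounded_fock M /\
  forall (i : 'I_n) (f : fock K), l2 f -> M (shift i f) = shift i (M f).

Definition inner (K K' : hilbert R) (M : fock K -> fock K') :=
  multi_analytic M /\ forall f : fock K, l2 f -> fnorm (M f) = fnorm f.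

(* outer operator psi : H -> F^2(H_n) (x) K : the closed linear span of
   (S_alpha (x) I_K) psi H is all of F^2(H_n) (x) K.  (Since psi H is a linear
   subspace, the linear span is formed by finite sums of S_alpha psi h.) *)
Definition outer (H K : hilbert R) (psi : H -> fock K) :=
  bounded_to_fock psi /\
  forall f : fock K, l2 f -> forall e : R, 0 < e ->
    exists s : seq (word * H),
      fnorm (fadd f (fopp (fun w => \sum_(p <- s) shiftw p.1 (psi p.2) w))) < e.

Definition symbol (K K' : hilbert R) (M : fock K -> fock K') : K -> fock K' :=
  fun h => M (vac h).

Definition outer_ma (K K' : hilbert R) (M : fock K -> fock K') :=
  multi_analytic M /\ outer (symbol M).

End Fock.

(* Main.v *)
From Pilot Require Import Defs.
From HB Require Import structures.
From mathcomp Require Import all_boot all_order all_algebra.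
From mathcomp Require Import complex.
From mathcomp Require Import all_classical all_reals.
From mathcomp Require Import constructive_ereal ereal esum.
From mathcomp Require Import topology normedtype sequences.
From mathcomp Require Import ring lra.
(* The analysis libraries shadow [shift]. *)
Import Pilot.Defs.
Set Implicit Arguments. Unset Strict Implicit. Unset Printing Implicit Defensive.
Import Order.TTheory GRing.Theory Num.Theory.
Import numFieldNormedType.Exports.
Local Open Scope classical_set_scope.
Local Open Scope ring_scope.

(* Let M be the smallest closed subspace of F^2(H_n) (x) H_2 that contains the
   range of theta and is invariant under the S_i.  Take for H_3 the wandering
   subspace M minus (S_1 M + ... + S_n M), and put chi f = sum_alpha S_alpha f(alpha).
   The summands are orthogonal, so chi is isometric; if g in M is
   orthogonal to its range, then g([::]) = 0 and each S_i^* g lies in M and is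
   again orthogonal to the range, so g = 0 by induction on the length of words.
   Thus M is exactly the range of chi, and psi = chi^-1 theta is outer.
   Given a second factorization, V = chi'^-1 chi is a unitary commuting with the
   shifts; it maps vacuum vectors, which are those orthogonal to the ranges of
   the S_i, to vacuum vectors, hence V = I (x) U.
   For (ii) one applies it to the symbol of M_theta: by density of finitely
   supported families the range of M_theta lies in M, so chi^-1 M_theta makes
   sense on the whole Fock space. *)

(** * Inner products and norms in complex Hilbert spaces *)

Section HilbertSpaces.
Variable R : realType.

Local Notation I := (Complex 0 1 : R[i]).

Lemma conjE (z : R[i]) : z^* = conjc z.
Proof. by []. Qed.

Lemma ReD (a b : R[i]) : complex.Re (a + b) = complex.Re a + complex.Re b.
Proof. by case: a; case: b. Qed.

Lemma ReM (a b : R[i]) : complex.Re (a * b) =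
  complex.Re a * complex.Re b - complex.Im a * complex.Im b.
Proof. by case: a; case: b. Qed.

Lemma mul_I_I : I * I = -1.
Proof. by apply/eqP; rewrite eq_complex /=; apply/andP; split; apply/eqP; ring. Qed.

Section OneSpace.
Variable H : hilbert R.
Implicit Types x y z : H.

Lemma hdotDl x y z : hdot (x + y) z = hdot x z + hdot y z.
Proof. by have := hdot_linl 1 x y z; rewrite scale1r mul1r. Qed.

Lemma hdot0l y : hdot 0 y = 0.
Proof. by apply: (addrI (hdot 0 y)); rewrite -hdotDl !addr0. Qed.

Lemma hdotZl a x z : hdot (a *: x) z = a * hdot x z.
Proof. by have := hdot_linl a x 0 z; rewrite addr0 hdot0l addr0. Qed.

Lemma hdotNl x z : hdot (- x) z = - hdot x z.
Proof. by rewrite -scaleN1r hdotZl mulN1r. Qed.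

Lemma hdot_eq0C x y : hdot x y = 0 -> hdot y x = 0.
Proof. by rewrite (hdot_conj x y) => ->; rewrite rmorph0. Qed.

(** The real inner product carries norms and orthogonality, so estimates are made with it; [hdotE]
    recovers the complex one. *)
Definition rdot x y : R := complex.Re (hdot x y).

Lemma rdotC x y : rdot x y = rdot y x.
Proof. by rewrite /rdot (hdot_conj y x) conjE; case: (hdot y x). Qed.

Lemma rdotDl x y z : rdot (x + y) z = rdot x z + rdot y z.
Proof. by rewrite /rdot hdotDl ReD. Qed.

Lemma rdotDr x y z : rdot z (x + y) = rdot z x + rdot z y.
Proof. by rewrite rdotC rdotDl !(rdotC z). Qed.

Lemma rdotNl x z : rdot (- x) z = - rdot x z.
Proof. by rewrite /rdot hdotNl; case: hdot. Qed.

Lemma rdotNr x z : rdot z (- x) = - rdot z x.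
Proof. by rewrite rdotC rdotNl rdotC. Qed.

Lemma rdot0l z : rdot 0 z = 0. Proof. by rewrite /rdot hdot0l. Qed.
Lemma rdot0r z : rdot z 0 = 0. Proof. by rewrite rdotC rdot0l. Qed.

Lemma rdotZl (r : R) x z : rdot (r%:C%C *: x) z = r * rdot x z.
Proof. by rewrite /rdot hdotZl ReM /= mul0r subr0. Qed.

Lemma rdotZr (r : R) x z : rdot z (r%:C%C *: x) = r * rdot z x.
Proof. by rewrite rdotC rdotZl rdotC. Qed.

(** Multiplying by [I] turns the imaginary part into a real part, up to sign. Hence a linear map
    that preserves [rdot] also preserves [hdot]. *)
Lemma hdotE x y : hdot x y = Complex (rdot x y) (- rdot (I *: x) y).
Proof.
by rewrite /rdot hdotZl ReM /= mul0r mul1r sub0r opprK; case: hdot.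
Qed.

Lemma rdotII x y : rdot (I *: x) (I *: y) = rdot x y.
Proof.
rewrite /rdot hdotZl (hdot_conj (I *: y)) hdotZl (hdot_conj y x) !conjE.
by case: (hdot y x) => a b /=; ring.
Qed.

Lemma rdotIC x y : rdot (I *: y) x = - rdot (I *: x) y.
Proof.
by rewrite -rdotII scalerA mul_I_I scaleN1r rdotC -scaleN1r -(rdotC (_ *: y));
   rewrite scaleN1r rdotNl (rdotC y).
Qed.

Definition rdotE := (rdotDl, rdotDr, rdotNl, rdotNr, rdotZl, rdotZr,
  rdot0l, rdot0r).

Lemma rdot_ge0 x : 0 <= rdot x x.
Proof.
have [->|/hdot_pos] := eqVneq x 0; first by rewrite rdot0l.
by rewrite ltcE /= => /andP[_ /ltW].
Qed.

Lemma rdot_eq0 x : rdot x x = 0 -> x = 0.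
Proof.
move=> h; apply/eqP/negP => /negP /hdot_pos.
by rewrite ltcE /= -/(rdot x x) h ltxx andbF.
Qed.

Lemma hnormE x : hnorm x ^+ 2 = rdot x x.
Proof. by rewrite sqr_sqrtr // rdot_ge0. Qed.

Lemma hnorm_ge0 x : 0 <= hnorm x. Proof. exact: sqrtr_ge0. Qed.

Lemma hnorm0 : hnorm (0 : H) = 0.
Proof. by rewrite /hnorm hdot0l sqrtr0. Qed.

Lemma hnorm_eq0 x : hnorm x = 0 -> x = 0.
Proof. by move=> h; apply: rdot_eq0; rewrite -hnormE h expr0n. Qed.

Lemma hnormN x : hnorm (- x) = hnorm x.
Proof. by rewrite /hnorm -!/(rdot _ _) !rdotE opprK. Qed.

Lemma hnormBC x y : hnorm (x - y) = hnorm (y - x).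
Proof. by rewrite -hnormN opprB. Qed.

Lemma hnormZ a x : hnorm (a *: x) = Normc.normc a * hnorm x.
Proof.
have -> : Normc.normc a = Num.sqrt (complex.Re a ^+ 2 + complex.Im a ^+ 2).
  by case: a.
rewrite /hnorm -sqrtrM ?addr_ge0 ?sqr_ge0 //.
rewrite hdotZl (hdot_conj (a *: x) x) hdotZl conjE; congr Num.sqrt.
(* Conjugate symmetry makes the imaginary part [v] of [hdot x x] its own opposite. *)
have := hdot_conj x x; rewrite conjE.
by case: (hdot x x) => u v; case: a => c d /= [] vE; ring: vE.
Qed.

Lemma cauchy_schwarz x y : rdot x y <= hnorm x * hnorm y.
Proof.
have [->|yN0] := eqVneq y 0; first by rewrite rdot0r hnorm0 mulr0.
have yy : 0 < rdot y y.
  by rewrite lt_neqAle rdot_ge0 andbT eq_sym; apply: contra_neq yN0 => /rdot_eq0.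
(* The coefficient of the projection of [x] onto [y]; the inequality is the nonnegativity of the
   squared remainder. *)
pose t := rdot x y / rdot y y.
have := rdot_ge0 (x - t%:C%C *: y).
rewrite !rdotE (rdotC y x) => h.
have {h} : rdot x y ^+ 2 <= rdot x x * rdot y y.
  have tE : t * rdot y y = rdot x y by rewrite /t divfK ?gt_eqF.
  have : 0 <= rdot x x - t * rdot x y by nra.
  rewrite subr_ge0 => h2.
  have -> : rdot x y ^+ 2 = t * rdot x y * rdot y y by rewrite mulrAC tE.
  by rewrite ler_pM2r.
rewrite -!hnormE -exprMn => h; apply: le_trans (ler_norm _) _.
by rewrite -ler_sqr ?nnegrE ?mulr_ge0 ?hnorm_ge0 // real_normK ?num_real.
Qed.

Lemma hnormD x y : hnorm (x + y) <= hnorm x + hnorm y.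
Proof.
rewrite -ler_sqr ?nnegrE ?addr_ge0 ?hnorm_ge0 // sqrrD !hnormE !rdotE.
by have := cauchy_schwarz x y; rewrite (rdotC y x); lra.
Qed.

Lemma hnormB_trans x y z : hnorm (x - z) <= hnorm (x - y) + hnorm (y - z).
Proof. by rewrite -[x - z](subrKA y); exact: hnormD. Qed.

(** The difference of the two sides is the square of [x - y]. In contrast to the triangle
    inequality, this form can be summed over words. *)
Lemma rdot_add_sq x y : rdot (x + y) (x + y) <= 2 * rdot x x + 2 * rdot y y.
Proof. by have := rdot_ge0 (x - y); rewrite !rdotE (rdotC y x); lra. Qed.

End OneSpace.

(** * Closed subspaces and orthogonal projection *)

Record csubspace (H : hilbert R) := CSubspace {
  in_csub :> H -> Prop;
  csub0 : in_csub 0;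
  csub_lin : forall a x y, in_csub x -> in_csub y -> in_csub (a *: x + y);
  csub_closed : forall x,
    (forall e : R, 0 < e -> exists2 y, in_csub y & hnorm (x - y) < e) ->
    in_csub x
}.

Section Subspaces.
Variables (H : hilbert R) (C : csubspace H).

Lemma csubZ a x : C x -> C (a *: x).
Proof. by move=> Cx; rewrite -[_ *: _]addr0; apply: csub_lin (csub0 C). Qed.

Lemma csubD x y : C x -> C y -> C (x + y).
Proof. by move=> Cx Cy; rewrite -[x]scale1r; apply: csub_lin. Qed.

Lemma csubB x y : C x -> C y -> C (x - y).
Proof. by move=> Cx Cy; rewrite addrC -scaleN1r; apply: csub_lin. Qed.

Lemma csub_sum (T : Type) (s : seq T) (F : T -> H) :
  (forall i, C (F i)) -> C (\sum_(i <- s) F i).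
Proof. by move=> CF; elim/big_ind: _ => //; [exact: csub0|exact: csubD]. Qed.

(** A subspace is stable under multiplication by [I], so vanishing of the real parts at [I *: s]
    gives vanishing of the imaginary parts at [s]. *)
Lemma hdot_re0 (x : H) :
  (forall s, C s -> rdot x s = 0) -> forall s, C s -> hdot x s = 0.
Proof.
move=> h s Cs; rewrite hdotE h // -rdotII scalerA mul_I_I scaleN1r rdotNl.
by rewrite h ?opprK //; apply: csubZ.
Qed.

(* Successive minimizers of the distance to C form a Cauchy sequence by the
   parallelogram law. *)
Lemma projection (x : H) :
  exists2 p, C p & forall s, C s -> hdot (x - p) s = 0.
Proof.
pose A : set R := [set rdot (x - y) (x - y) | y in [set y | C y]]%classic.
have A0 : has_inf A.
  split; first by exists (rdot (x - 0) (x - 0)), 0 => //; exact: csub0.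
  by exists 0 => _ [y _ <-]; exact: rdot_ge0.
pose D := inf A.
have D0 : 0 <= D by apply: lb_le_inf; [case: A0|move=> _ [y _ <-]; exact: rdot_ge0].
have leD y : C y -> D <= rdot (x - y) (x - y).
  by move=> Cy; apply: ge_inf; [case: A0|exists y].
have near e : 0 < e -> exists y, C y /\ rdot (x - y) (x - y) < D + e.
  by move=> e0; have [_ [y Cy <-] ?] := inf_adherent e0 A0; exists y.
pose d k : R := k.+1%:R^-1.
have d0 k : 0 < d k by rewrite invr_gt0 ltr0n.
have /choice[u uP] : forall k, exists y, C y /\ rdot (x - y) (x - y) < D + d k.
  by move=> k; apply: near.
have dsmall e : 0 < e -> exists N, forall k, (N <= k)%N -> d k < e.
  move=> e0; exists (Num.bound e^-1) => k Nk; rewrite /d -[e]invrK ltf_pV2.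
  - apply: lt_le_trans (archi_boundP _) _; first by rewrite invr_ge0 ltW.
    by rewrite ler_nat (leq_trans Nk).
  - by rewrite posrE ltr0n.
  - by rewrite posrE invr_gt0.
(* The midpoint of [u m] and [u k] lies in [C], so its squared distance to [x] is at least [D]. *)
have dist m k : rdot (u m - u k) (u m - u k) <= 2 * (d m + d k).
  have [Cm um] := uP m; have [Ck uk] := uP k.
  have := leD _ (csubZ (2^-1)%:C%C (csubD Cm Ck)).
  rewrite !rdotE (rdotC (u m) x) (rdotC (u k) x) (rdotC (u k) (u m)) => h.
  by move: um uk; rewrite !rdotE (rdotC (u m) x) (rdotC (u k) x); lra.
have [p up] : exists p, forall e : R, 0 < e -> exists N : nat, forall m, (N <= m)%N ->
    hnorm (u m - p) < e.
  apply: hcomplete => e e0.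
  have [|N NP] := dsmall (e ^+ 2 / 4); first by rewrite divr_gt0 ?exprn_gt0.
  exists N => m k Nm Nk; rewrite -/(hnorm _).
  rewrite -ltr_sqr ?nnegrE ?hnorm_ge0 ?ltW // hnormE.
  by have := dist m k; have := NP m Nm; have := NP k Nk; lra.
have Cp : C p.
  apply: csub_closed => e e0; have [N NP] := up e e0.
  by exists (u N); [case: (uP N)|rewrite hnormBC; exact: NP].
have pD : rdot (x - p) (x - p) <= D.
  rewrite -hnormE -[leRHS]sqr_sqrtr // ler_sqr ?nnegrE ?hnorm_ge0 ?sqrtr_ge0 //.
  apply/ler_addgt0Pr => e e0.
  have e20 : 0 < e / 2 by lra.
  have [N1 NP1] := up _ e20.
  have [|N2 NP2] := dsmall ((e / 2) ^+ 2); first by rewrite exprn_gt0.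
  pose k := maxn N1 N2.
  apply: le_trans (hnormB_trans x (u k) p) _.
  have := NP1 k (leq_maxl _ _); have := NP2 k (leq_maxr _ _) => h2 h1.
  have : hnorm (x - u k) <= Num.sqrt D + e / 2; last by lra.
  rewrite -ler_sqr ?nnegrE ?hnorm_ge0 ?addr_ge0 ?sqrtr_ge0 // ?ltW //.
  rewrite hnormE sqrrD sqr_sqrtr //.
  have [_ ukD] := uP k; apply: lt_trans ukD _.
  have : 0 <= Num.sqrt D * (e / 2) by rewrite mulr_ge0 ?sqrtr_ge0 ?ltW.
  rewrite mulr2n.
  move: (_ * (e / 2)) h2 => a; move: (_ ^+ 2) (d k) => b c. lra.
exists p => //; apply: hdot_re0 => s Cs.
(* First variation: moving [p] by a multiple of [s] stays in [C] and cannot come closer to [x]. *)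
have var (t : R) : 0 <= t ^+ 2 * rdot s s - 2 * t * rdot (x - p) s.
  have := leD _ (csubD Cp (csubZ t%:C%C Cs)).
  rewrite opprD addrA; move: (x - p) pD => z zD.
  by rewrite !rdotE (rdotC s z); lra.
have ss := rdot_ge0 s; set c := rdot (x - p) s in var *.
have [s0|sN0] := eqVneq (rdot s s) 0.
  by have := var c; rewrite s0; have := sqr_ge0 c; nra.
(* This [t] minimizes the quadratic in [var]; nonnegativity of the minimum forces [c] to vanish. *)
have := var (c / rdot s s).
have -> : (c / rdot s s) ^+ 2 * rdot s s - 2 * (c / rdot s s) * c
   = - (c ^+ 2 / rdot s s) by field.
rewrite oppr_ge0 => h; apply/eqP; rewrite -sqrf_eq0.
have h2 : c ^+ 2 <= 0 by move: h; rewrite pmulr_lle0 // invr_gt0 lt_neqAle eq_sym sN0.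
by rewrite eq_le h2 sqr_ge0.
Qed.

End Subspaces.

(** * Linear maps and isometries *)

Section LinearMaps.
Variables (H K : hilbert R) (f : H -> K).
Hypothesis fL : linear_map f.

Lemma linear_mapD x y : f (x + y) = f x + f y.
Proof. by have := fL 1 x y; rewrite !scale1r. Qed.

Lemma linear_map0 : f 0 = 0.
Proof. by apply: (addrI (f 0)); rewrite -linear_mapD !addr0. Qed.

Lemma linear_mapZ a x : f (a *: x) = a *: f x.
Proof. by have := fL a x 0; rewrite linear_map0 !addr0. Qed.

Lemma linear_mapB x y : f (x - y) = f x - f y.
Proof. by rewrite addrC -scaleN1r fL scaleN1r addrC. Qed.

Lemma linear_map_sum (T : Type) (s : seq T) (F : T -> H) :
  f (\sum_(i <- s) F i) = \sum_(i <- s) f (F i).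
Proof. exact: (big_morph f linear_mapD linear_map0). Qed.

(** A contraction is continuous, so preservation of the norm passes to limits. It later extends the
    isometry property of [chiL] from truncations to all families. *)
Lemma contraction_isometric_at x :
  (forall z, hnorm (f z) <= hnorm z) ->
  (forall e : R, 0 < e ->
     exists y, hnorm (x - y) < e /\ hnorm (f y) = hnorm y) ->
  hnorm (f x) = hnorm x.
Proof.
move=> fC h; apply/eqP; rewrite eq_le fC; apply/ler_addgt0Pr => e e0.
have [|y [xy fy]] := h (e / 2); first by lra.
have h1 := hnormD (x - y) y.
have h2 := hnormD (f x) (f (y - x)).
have h3 := fC (y - x).
rewrite -linear_mapD addrC subrK fy in h2.
by rewrite subrK in h1; rewrite (hnormBC y x) in h3; lra.
Qed.

Hypothesis fN : forall x, hnorm (f x) = hnorm x.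

(** Polarization: the inner product is read off from the squared norms of [x], [y] and [x + y]. *)
Lemma isometry_rdot x y : rdot (f x) (f y) = rdot x y.
Proof.
have := hnormE (x + y); rewrite -fN hnormE linear_mapD !rdotE.
rewrite (rdotC y) (rdotC (f y)) -(hnormE (f x)) -(hnormE (f y)) !fN !hnormE.
lra.
Qed.

Lemma isometry_hdot x y : hdot (f x) (f y) = hdot x y.
Proof. by rewrite hdotE -linear_mapZ !isometry_rdot -hdotE. Qed.

Lemma isometry_inj x y : f x = f y -> x = y.
Proof.
move=> e; apply/eqP; rewrite -subr_eq0; apply/eqP/hnorm_eq0.
by rewrite -fN linear_mapB e subrr hnorm0.
Qed.

(** If images converge to [y], their preimages form a Cauchy sequence because distances are
    preserved; the limit of the preimages is mapped to [y]. *)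
Lemma isometry_range_closed (y : K) :
  (forall e : R, 0 < e -> exists x, hnorm (y - f x) < e) -> exists x, f x = y.
Proof.
move=> h.
have /choice[u uP] : forall k : nat, exists x, hnorm (y - f x) < k.+1%:R^-1.
  by move=> k; apply: h; rewrite invr_gt0 ltr0n.
have uy e : 0 < e -> exists N, forall m, (N <= m)%N -> hnorm (y - f (u m)) < e.
  move=> e0; exists (Num.bound e^-1) => k Nk.
  apply: lt_trans (uP k) _; rewrite invf_plt ?posrE ?ltr0n //.
  have : e^-1 < (Num.bound e^-1)%:R by apply: archi_boundP; rewrite invr_ge0 ltW.
  by move=> /lt_le_trans; apply; rewrite ler_nat ltnW.
have [e e0|x xP] := @hcomplete _ H u.
  have e20 : 0 < e / 2 by lra.
  have [N NP] := uy _ e20; exists N => m k Nm Nk; rewrite -/(hnorm _).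
  rewrite -fN linear_mapB; apply: le_lt_trans (hnormB_trans _ y _) _.
  by rewrite hnormBC; have := NP _ Nm; have := NP _ Nk; lra.
exists x; apply/eqP; rewrite -subr_eq0; apply/eqP/hnorm_eq0/eqP.
rewrite eq_le hnorm_ge0 andbT; apply/ler_addgt0Pr => e e0; rewrite add0r.
have e20 : 0 < e / 2 by lra.
have [N1 NP1] := uy _ e20; have [N2 NP2] := xP _ e20.
have := NP1 _ (leq_maxl N1 N2); have := NP2 _ (leq_maxr N1 N2).
move: (maxn _ _) => k; rewrite -/(hnorm _) => h2 h1.
apply: le_trans (hnormB_trans _ (f (u k)) _) _.
by rewrite -linear_mapB fN (hnormBC x) (hnormBC (f (u k))); lra.
Qed.

End LinearMaps.

Lemma linear_map_comp (H K L : hilbert R) (g : K -> L) (f : H -> K) :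
  linear_map g -> linear_map f -> linear_map (g \o f).
Proof. by move=> gL fL a x y; rewrite /= fL gL. Qed.

(** Preimages under an isometry are unique, hence depend linearly on the image. All quotients below,
    such as chi^-1 theta, are formed this way. *)
Lemma isometry_factor (G H K : hilbert R) (f : H -> K) (t : G -> K) :
  linear_map f -> (forall x, hnorm (f x) = hnorm x) -> linear_map t ->
  (forall y, exists x, f x = t y) ->
  exists2 g : G -> H, linear_map g & forall y, f (g y) = t y.
Proof.
move=> fL fN tL /choice[g gP]; exists g => // a x y.
by apply: (isometry_inj fL fN); rewrite fL !gP tL.
Qed.

(** * Closure of a linear subspace *)

Section ClosureOfSubspace.
Variables (H : hilbert R) (P : H -> Prop).
Hypotheses (P0 : P 0) (PL : forall a x y, P x -> P y -> P (a *: x + y)).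

Definition in_closure x :=
  forall e : R, 0 < e -> exists2 y, P y & hnorm (x - y) < e.

Lemma in_closure_lin a x y :
  in_closure x -> in_closure y -> in_closure (a *: x + y).
Proof.
(* The added 1 keeps the divisor [c] positive when [a] is 0. *)
move=> hx hy e e0; pose c := Normc.normc a + 1.
have a0 : 0 <= Normc.normc a by case: a @c => u v; exact: sqrtr_ge0.
have c0 : 0 < c by rewrite /c; lra.
have [|x' Px' xx'] := hx (e / 2 / c); first by rewrite !divr_gt0.
have [|y' Py' yy'] := hy (e / 2); first by rewrite divr_gt0.
exists (a *: x' + y'); first exact: PL.
rewrite opprD addrACA -scalerBr; apply: le_lt_trans (hnormD _ _) _.
rewrite hnormZ; have : Normc.normc a * hnorm (x - x') <= e / 2; last by lra.
move: xx'; rewrite ltr_pdivlMr // => h; have := hnorm_ge0 (x - x').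
by move: h; rewrite /c; nra.
Qed.

Lemma in_closure_closed x :
  (forall e : R, 0 < e -> exists2 y, in_closure y & hnorm (x - y) < e) ->
  in_closure x.
Proof.
move=> h e e0; have e20 : 0 < e / 2 by lra.
have [y yP xy] := h _ e20; have [z zP yz] := yP _ e20; exists z => //.
by have := hnormB_trans x y z; lra.
Qed.

Lemma in_closure_sub x : P x -> in_closure x.
Proof. by move=> Px e e0; exists x; rewrite // subrr hnorm0. Qed.

Definition csub_closure := CSubspace (in_closure_sub P0) in_closure_lin
  in_closure_closed.

End ClosureOfSubspace.

(** * Relative orthogonal complements *)

Section OrthogonalComplement.
Variables (H : hilbert R) (C D : csubspace H).

Definition in_ortho x := C x /\ forall y, D y -> hdot x y = 0.

Lemma in_ortho0 : in_ortho 0.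
Proof. by split; [exact: csub0|move=> y _; exact: hdot0l]. Qed.

Lemma in_ortho_lin a x y : in_ortho x -> in_ortho y -> in_ortho (a *: x + y).
Proof.
move=> [Cx hx] [Cy hy]; split; first exact: csub_lin.
by move=> z Dz; rewrite hdot_linl hx // hy // mulr0 addr0.
Qed.

Lemma in_ortho_closed x :
  (forall e : R, 0 < e -> exists2 y, in_ortho y & hnorm (x - y) < e) ->
  in_ortho x.
Proof.
move=> h; split.
  by apply: csub_closed => e /h[y [Cy _] ?]; exists y.
apply: hdot_re0 => s Ds; apply/eqP; rewrite -normr_le0.
apply/ler_addgt0Pr => e e0; rewrite add0r.
(* By Cauchy-Schwarz this distance makes [rdot x s] at most [e] in absolute value; the added 1
   covers [s] of norm 0. *)
have := hnorm_ge0 s => s0; have [|y [_ yP] xy] := h (e / (hnorm s + 1)).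
  by rewrite divr_gt0 //; lra.
have ys : rdot y s = 0 by rewrite /rdot yP.
have -> : rdot x s = rdot (x - y) s by rewrite rdotDl rdotNl ys subr0.
have : hnorm (x - y) * hnorm s <= e.
  move: xy; rewrite ltr_pdivlMr; last by lra.
  by have := hnorm_ge0 (x - y); nra.
have := cauchy_schwarz (x - y) s; have := cauchy_schwarz (- (x - y)) s.
by rewrite hnormN rdotNl ler_norml; lra.
Qed.

Definition csub_ortho := CSubspace in_ortho0 in_ortho_lin in_ortho_closed.

End OrthogonalComplement.

(** * A closed subspace as a Hilbert space in its own right *)

Section SubHilbert.
Variables (H : hilbert R) (C : csubspace H).

(** The boolean form of membership required by the subtype and submodule structures. *)
Definition csub_pred : {pred H} := fun x => `[< C x >].

Lemma csub_predP x : reflect (C x) (x \in csub_pred).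
Proof. exact: asboolP. Qed.

Lemma csub_submod : submod_closed csub_pred.
Proof.
split; first by apply/csub_predP; exact: csub0.
by move=> a x y /csub_predP Cx /csub_predP Cy; apply/csub_predP; exact: csub_lin.
Qed.

HB.instance Definition _ := GRing.isSubmodClosed.Build R[i] H csub_pred csub_submod.

Record csub_of := CSubOf { csub_val : H; _ : csub_val \in csub_pred }.

HB.instance Definition _ := [isSub for csub_val].
HB.instance Definition _ := [Choice of csub_of by <:].
HB.instance Definition _ := [SubChoice_isSubLmodule of csub_of by <:].

Fact csub_dot_linl (a : R[i]) (x y z : csub_of) :
  hdot (csub_val (a *: x + y)) (csub_val z) =
  a * hdot (csub_val x) (csub_val z) + hdot (csub_val y) (csub_val z).
Proof. by rewrite -hdot_linl. Qed.

Fact csub_dot_conj (x y : csub_of) :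
  hdot (csub_val y) (csub_val x) = (hdot (csub_val x) (csub_val y))^*.
Proof. exact: hdot_conj. Qed.

Fact csub_dot_pos (x : csub_of) : x != 0 -> 0 < hdot (csub_val x) (csub_val x).
Proof. by move=> x0; apply: hdot_pos; apply: contra_neq x0 => x0; exact: val_inj. Qed.

(** A limit exists in [H], and closedness of [C] keeps it in [C]. *)
Fact csub_complete (u : nat -> csub_of) :
  (forall e : R, 0 < e -> exists N : nat, forall m k : nat,
     (N <= m)%N -> (N <= k)%N ->
     Num.sqrt (complex.Re (hdot (csub_val (u m - u k)) (csub_val (u m - u k)))) < e) ->
  exists l : csub_of, forall e : R, 0 < e -> exists N : nat,
     forall m : nat, (N <= m)%N ->
     Num.sqrt (complex.Re (hdot (csub_val (u m - l)) (csub_val (u m - l)))) < e.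
Proof.
move=> h; have [l lP] := @hcomplete _ H (csub_val \o u) h.
have Cl : C l.
  apply: csub_closed => e e0; have [N NP] := lP _ e0.
  exists (csub_val (u N)); first by apply/csub_predP; exact: (valP (u N)).
  by rewrite hnormBC; exact: NP.
by exists (CSubOf (introT (csub_predP l) Cl)).
Qed.

Definition csub_hilbert : hilbert R :=
  Hilbert csub_dot_linl csub_dot_conj csub_dot_pos csub_complete.

Definition csub_incl (x : csub_hilbert) : H := csub_val x.

Lemma csub_inclP (x : csub_hilbert) : C (csub_incl x).
Proof. by apply/csub_predP; exact: (valP (x : csub_of)). Qed.

Lemma csub_incl_onto x : C x -> exists y, csub_incl y = x.
Proof. by move=> Cx; exists (CSubOf (introT (csub_predP x) Cx)). Qed.

End SubHilbert.
End HilbertSpaces.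

(** * Sums over words *)

Section WordSums.
Variables (R : realType) (n : nat).
Implicit Types u v : word n -> R.

(** A finite exhaustion of the free monoid by length, built on the first letter so that [psumS] can
    peel that letter off. *)
Fixpoint words (N : nat) : seq (word n) :=
  if N is N'.+1 then [::] :: [seq i :: w | i <- enum 'I_n, w <- words N']
  else [::].

Lemma mem_words N (w : word n) : (w \in words N) = (size w < N)%N.
Proof.
elim: N w => [|N IHN] [|i w] //=; rewrite inE /= ltnS -IHN.
apply/allpairsP/idP => [[[j v] /= [_ vN [_ ->]]] //|wN].
by exists (i, w); rewrite mem_enum.
Qed.

Lemma uniq_words N : uniq (words N).
Proof.
elim: N => //= N IHN; apply/andP; split; first by apply/negP => /allpairsP[[]] ? ? [].
by apply: allpairs_uniq => // [|[i v] [j w] _ _ [-> ->]] //; exact: enum_uniq.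
Qed.

Definition psum (N : nat) u : R := \sum_(w <- words N) u w.

Lemma psumS N u : psum N.+1 u = u [::] + \sum_(i < n) psum N (fun w => u (i :: w)).
Proof.
by rewrite /psum /= big_cons big_allpairs_dep big_enum.
Qed.

Lemma psum_ge0 N u : (forall w, 0 <= u w) -> 0 <= psum N u.
Proof. by move=> u0; apply: sumr_ge0. Qed.

Lemma psum_mono u : (forall w, 0 <= u w) -> nondecreasing_seq (fun N => psum N u).
Proof.
move=> u0; apply/nondecreasing_seqP => N.
elim: N u u0 => [|N IHN] u u0; first by rewrite {1}/psum big_nil psum_ge0.
by rewrite 2!psumS lerD2l; apply: ler_sum => i _; exact: IHN.
Qed.

Lemma le_psum N u v : (forall w, u w <= v w) -> psum N u <= psum N v.
Proof. by move=> uv; apply: ler_sum. Qed.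

(** Summation along word length makes sense for families of any sign, such as the terms of an inner
    product. *)
Definition ssum_to u (l : R) := (psum N u) @[N --> \oo] --> l.

Lemma ssum_to_unique u l l' : ssum_to u l -> ssum_to u l' -> l = l'.
Proof. by move=> h h'; apply: (cvg_unique _ h h'). Qed.

Lemma ssum_to_lin u v l k a b : ssum_to u l -> ssum_to v k ->
  ssum_to (fun w => a * u w + b * v w) (a * l + b * k).
Proof.
move=> ul vk; rewrite /ssum_to.
under eq_fun => N do rewrite /psum big_split -!mulr_sumr.
by apply: cvgD; apply: cvgMl_tmp.
Qed.

(** Words are split by their first letter; [rdot_recl] turns this into the orthogonal decomposition
    of the Fock space. *)
Lemma ssum_to_recl u (l : 'I_n -> R) :
  (forall i, ssum_to (fun w => u (i :: w)) (l i)) ->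
  ssum_to u (u [::] + \sum_i l i).
Proof.
move=> h; rewrite /ssum_to -cvg_shiftS /=.
under eq_fun => N do rewrite psumS.
apply: cvgD; first exact: cvg_cst.
by apply: (cvg_big (op := +%R)) => // [|i _]; [exact: add_continuous|exact: h].
Qed.

Section Esum.
Variable u : word n -> R.
Hypothesis u0 : forall w, 0 <= u w.

Let E := (\esum_(w in [set: word n]) (u w)%:E)%E.

Lemma psum_le_esum N : ((psum N u)%:E <= E)%E.
Proof.
apply: esum_ge; exists [set` words N]; last first.
  by rewrite -fsbig_seq ?uniq_words // sumEFin.
by split => //; exact: finite_seq.
Qed.

Lemma esum_le_psum (C : R) : (forall N, psum N u <= C) -> (E <= C%:E)%E.
Proof.
move=> uC; apply: ge_ereal_sup => _ [X [/finite_seqP[s ->] _] <-].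
have -> : [set` s] = [set` undup s] by apply/seteqP; split => w /=; rewrite mem_undup.
rewrite -fsbig_seq ?undup_uniq // sumEFin lee_fin.
(* One more than the greatest length, since [words N] lists the words of length strictly below
   [N]. *)
pose N := (\max_(w <- undup s) size w).+1; apply: le_trans (uC N).
have sN w : w \in undup s -> w \in words N.
  by move=> ws; rewrite mem_words ltnS; exact: (leq_bigmax_seq (F := size)).
have pe : perm_eq (undup s) [seq w <- words N | w \in undup s].
  apply: uniq_perm; rewrite ?undup_uniq ?filter_uniq ?uniq_words // => w.
  by rewrite mem_filter; case: (boolP (w \in undup s)) => //= /sN ->.
rewrite (perm_big _ pe) big_filter /psum [leRHS](bigID [in undup s]).
by rewrite lerDl sumr_ge0.
Qed.

Lemma ssum_to_esum : (E < +oo)%E -> ssum_to u (fine E).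
Proof.
move=> Eoo.
have Efin : E \is a fin_num.
  by rewrite ge0_fin_numE //; apply: esum_ge0 => w _; rewrite lee_fin.
have leE N : psum N u <= fine E by rewrite -lee_fin fineK // psum_le_esum.
(* Nondecreasing partial sums converge to their supremum, so only this supremum has to be
   identified. *)
suff -> : fine E = sup (range (fun N => psum N u)).
  apply: nondecreasing_cvgn; first exact: psum_mono.
  by exists (fine E) => _ [N _ <-].
apply/eqP; rewrite eq_le; apply/andP; split; last first.
  by apply: ge_sup; [exists (psum 0 u), 0%N|move=> _ [N _ <-]].
rewrite -lee_fin fineK //; apply: esum_le_psum => N.
by apply: ub_le_sup; [exists (fine E) => _ [k _ <-]|exists N].
Qed.

Lemma psum_le_ssum l N : ssum_to u l -> psum N u <= l.
Proof.
move=> ul; have <- := cvg_lim (@Rhausdorff R) ul.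
apply: nondecreasing_cvgn_le; first exact: psum_mono.
by apply/cvg_ex; exists l.
Qed.

Lemma ssum_to_le l C : (forall N, psum N u <= C) -> ssum_to u l -> l <= C.
Proof. by move=> uC ul; apply: (cvgr_to_le ul); near=> N. Unshelve. all: by end_near. Qed.

End Esum.
End WordSums.

Arguments ssum_to_lin {R n u v l k} a b.

(** * The Hilbert space of square-summable families *)

Section SquareSummable.
Variables (R : realType) (n : nat) (K : hilbert R).
Implicit Types f g h : fock n K.

Local Notation I := (Complex 0 1 : R[i]).
Local Notation sq f := (fun w => rdot (f w) (f w)).

Lemma sq_ge0 f w : 0 <= sq f w. Proof. exact: rdot_ge0. Qed.

Lemma fock_sqsumE f : fock_sqsum f = (\esum_(w in [set: word n]) (sq f w)%:E)%E.
Proof. by apply: eq_esum => w _; rewrite hnormE. Qed.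

Lemma l2P f : l2 f <-> exists C, forall N, psum N (sq f) <= C.
Proof.
rewrite /l2 fock_sqsumE; split => [foo|[C fC]].
  exists (fine (fock_sqsum f)) => N; rewrite fock_sqsumE.
  by apply: psum_le_ssum (ssum_to_esum _ foo); exact: sq_ge0.
exact: le_lt_trans (esum_le_psum (sq_ge0 _) fC) (ltry _).
Qed.

Lemma ssum_to_fock_sqsum f : l2 f -> ssum_to (sq f) (fine (fock_sqsum f)).
Proof.
by rewrite /l2 fock_sqsumE; apply: ssum_to_esum; exact: sq_ge0.
Qed.

Lemma l2_0 : l2 (0 : fock n K).
Proof. by apply/l2P; exists 0 => N; rewrite /psum big1 // => w _; rewrite rdot0l. Qed.

Lemma l2_lin (a : R[i]) f g : l2 f -> l2 g -> l2 (a *: f + g).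
Proof.
move=> /l2P[C fC] /l2P[D gD]; apply/l2P.
exists (2 * (Normc.normc a ^+ 2 * C) + 2 * D) => N.
apply: (@le_trans _ _ (psum N (fun w => 2 * (Normc.normc a ^+ 2 * sq f w) + 2 * sq g w))).
  apply: le_psum => w; apply: le_trans (rdot_add_sq _ _) _.
  by rewrite -hnormE hnormZ exprMn !hnormE.
rewrite /psum big_split -!mulr_sumr; apply: lerD; rewrite ler_pM2l //; last exact: gD.
by apply: ler_wpM2l; [exact: sqr_ge0|exact: fC].
Qed.

Lemma l2Z (a : R[i]) f : l2 f -> l2 (a *: f).
Proof. by move=> fl; rewrite -[_ *: _]addr0; apply: l2_lin l2_0. Qed.

Lemma l2D f g : l2 f -> l2 g -> l2 (f + g).
Proof. by move=> fl gl; rewrite -[f]scale1r; apply: l2_lin. Qed.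

(** The real inner product, defined by polarization; [ssum_to_fdot] identifies it with the sum of
    the pointwise products. *)
Definition fdot f g : R :=
  (fine (fock_sqsum (f + g)) - fine (fock_sqsum f) - fine (fock_sqsum g)) / 2.

Lemma ssum_to_fdot f g : l2 f -> l2 g ->
  ssum_to (fun w => rdot (f w) (g w)) (fdot f g).
Proof.
move=> fl gl.
have h1 := ssum_to_fock_sqsum (l2D fl gl).
have := ssum_to_lin (2^-1) (- 2^-1) h1
  (ssum_to_lin 1 1 (ssum_to_fock_sqsum fl) (ssum_to_fock_sqsum gl)).
congr (ssum_to _ _); last by rewrite /fdot; field.
by apply/funext => w /=; rewrite !rdotE (rdotC (g w)); field.
Qed.

Lemma fdotC f g : fdot f g = fdot g f.
Proof. by rewrite /fdot (addrC f g); ring. Qed.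

(** Since [fdot] is only real linear, the imaginary part [d] of the scalar acts through [I *: f]. *)
Lemma fdot_linl c d f g h : l2 f -> l2 g -> l2 h ->
  fdot (Complex c d *: f + g) h = c * fdot f h + d * fdot (I *: f) h + fdot g h.
Proof.
move=> fl gl hl; apply: (ssum_to_unique (ssum_to_fdot (l2_lin _ fl gl) hl)).
have := ssum_to_lin 1 1 (ssum_to_lin c d (ssum_to_fdot fl hl) (ssum_to_fdot (l2Z I fl) hl))
  (ssum_to_fdot gl hl).
congr (ssum_to _ _); last by rewrite !mul1r.
apply/funext => w /=; rewrite !mul1r rdotDl; congr (_ + _).
rewrite /rdot !hdotZl !ReM /=; ring.
Qed.

Lemma fdotIC f g : l2 f -> l2 g -> fdot (I *: g) f = - fdot (I *: f) g.
Proof.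
move=> fl gl; apply: (ssum_to_unique (ssum_to_fdot (l2Z _ gl) fl)).
have := ssum_to_lin (-1) 0 (ssum_to_fdot (l2Z I fl) gl) (ssum_to_fdot (l2Z I fl) gl).
congr (ssum_to _ _); last by rewrite mul0r addr0 mulN1r.
by apply/funext => w; rewrite mul0r addr0 mulN1r -rdotIC.
Qed.

Lemma fdotff f : l2 f -> fdot f f = fine (fock_sqsum f).
Proof.
by move=> fl; apply: ssum_to_unique (ssum_to_fdot fl fl) (ssum_to_fock_sqsum fl).
Qed.

Lemma psum_le_fdot N f : l2 f -> psum N (sq f) <= fdot f f.
Proof. by move=> fl; apply: psum_le_ssum (ssum_to_fdot fl fl); exact: sq_ge0. Qed.

Lemma rdot_le_fdot w f : l2 f -> rdot (f w) (f w) <= fdot f f.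
Proof.
move=> fl; apply: le_trans (psum_le_fdot (size w).+1 fl).
rewrite /psum (bigD1_seq w) ?mem_words ?uniq_words //.
by rewrite lerDl sumr_ge0 // => v _; exact: rdot_ge0.
Qed.

Definition l2_pred : {pred fock n K} := fun f => `[< l2 f >].

Lemma l2_predP f : reflect (l2 f) (f \in l2_pred).
Proof. exact: asboolP. Qed.

Lemma l2_submod : submod_closed l2_pred.
Proof.
split; first by apply/l2_predP; exact: l2_0.
by move=> a f g /l2_predP fl /l2_predP gl; apply/l2_predP; exact: l2_lin.
Qed.

HB.instance Definition _ :=
  GRing.isSubmodClosed.Build R[i] (fock n K) l2_pred l2_submod.

Record l2_of := L2Of { l2_val : fock n K; _ : l2_val \in l2_pred }.

HB.instance Definition _ := [isSub for l2_val].
HB.instance Definition _ := [Choice of l2_of by <:].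
HB.instance Definition _ := [SubChoice_isSubLmodule of l2_of by <:].

Lemma l2_valP (f : l2_of) : l2 (l2_val f).
Proof. by apply/l2_predP; exact: (valP f). Qed.

(** The imaginary part is built from the real inner product as in [hdotE]. *)
Definition l2_dot (f g : l2_of) : R[i] :=
  Complex (fdot (l2_val f) (l2_val g)) (- fdot (I *: l2_val f) (l2_val g)).

Fact l2_dot_linl (a : R[i]) (f g h : l2_of) :
  l2_dot (a *: f + g) h = a * l2_dot f h + l2_dot g h.
Proof.
have [fl gl hl] := And3 (l2_valP f) (l2_valP g) (l2_valP h).
rewrite /l2_dot; case: a => c d.
have -> : l2_val (Complex c d *: f + g) = Complex c d *: l2_val f + l2_val g by [].
have -> : I *: (Complex c d *: l2_val f + l2_val g) =
   Complex (- d) c *: l2_val f + I *: l2_val g.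
  rewrite scalerDr scalerA; congr (_ *: _ + _).
  by apply/eqP; rewrite eq_complex /=; apply/andP; split; apply/eqP; ring.
rewrite !fdot_linl //; last exact: l2Z.
by apply/eqP; rewrite eq_complex /=; apply/andP; split; apply/eqP; ring.
Qed.

Fact l2_dot_conj (f g : l2_of) : l2_dot g f = (l2_dot f g)^*.
Proof.
rewrite conjE /l2_dot /= (fdotC (l2_val g)) (fdotIC (l2_valP f) (l2_valP g)).
by rewrite opprK.
Qed.

Fact l2_dot_pos (f : l2_of) : f != 0 -> 0 < l2_dot f f.
Proof.
move=> f0; rewrite ltcE /=; apply/andP; split.
  by apply/eqP; have := fdotIC (l2_valP f) (l2_valP f); lra.
have [w fw] : exists w, l2_val f w <> 0.
  apply/existsNP => h; move/eqP: f0; apply; apply: val_inj; apply/funext => w; exact: h.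
apply: lt_le_trans (rdot_le_fdot w (l2_valP f)).
by rewrite lt_neqAle rdot_ge0 andbT eq_sym; apply/eqP => /rdot_eq0.
Qed.

(** A partial sum has finitely many terms, so convergence at each word suffices. *)
Lemma psum_pointwise_lim (u : nat -> fock n K) f N :
  (forall w (e : R), 0 < e ->
     exists M, forall m, (M <= m)%N -> hnorm (u m w - f w) < e) ->
  forall e : R, 0 < e ->
    exists M, forall m, (M <= m)%N -> psum N (sq (u m - f)) < e.
Proof.
move=> uf; rewrite /psum; move: (words n N) => ws; elim: ws => [|w s IHs] e e0.
  by exists 0%N => m _; rewrite big_nil.
have [|M1 h1] := uf w (Num.sqrt (e / 2)); first by rewrite sqrtr_gt0; lra.
have [|M2 h2] := IHs (e / 2); first by lra.
exists (maxn M1 M2) => m; rewrite geq_max => /andP[/h1 k1 /h2 k2].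
rewrite big_cons; suff : rdot ((u m - f) w) ((u m - f) w) < e / 2 by lra.
rewrite -hnormE -[ltRHS](@sqr_sqrtr _ (e / 2)); last by lra.
by rewrite ltr_sqr ?nnegrE ?hnorm_ge0 ?sqrtr_ge0.
Qed.

(** Completeness of [K] gives a limit at each word; the Cauchy estimate then passes to the limit on
    finite sets of words, uniformly in the set. *)
Fact l2_complete (u : nat -> l2_of) :
  (forall e : R, 0 < e -> exists N : nat, forall m k : nat,
     (N <= m)%N -> (N <= k)%N ->
     Num.sqrt (complex.Re (l2_dot (u m - u k) (u m - u k))) < e) ->
  exists l : l2_of, forall e : R, 0 < e -> exists N : nat,
     forall m : nat, (N <= m)%N ->
     Num.sqrt (complex.Re (l2_dot (u m - l) (u m - l))) < e.
Proof.
move=> /= uC; pose v m := l2_val (u m).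
have vl m : l2 (v m) := l2_valP (u m).
have {}uC e : 0 < e -> exists N, forall m k, (N <= m)%N -> (N <= k)%N ->
    fdot (v m - v k) (v m - v k) < e.
  move=> e0; have [|N NP] := uC (Num.sqrt e); first by rewrite sqrtr_gt0.
  by exists N => m k Nm Nk; have := NP m k Nm Nk; rewrite ltr_sqrt.
have vB m k : l2 (v m - v k) := l2_valP (u m - u k).
have /choice[f fP] : forall w, exists l, forall e : R, 0 < e -> exists N, forall m,
    (N <= m)%N -> hnorm (v m w - l) < e.
  move=> w; apply: hcomplete => e e0.
  have [|N NP] := uC (e ^+ 2); first by rewrite exprn_gt0.
  exists N => m k Nm Nk; rewrite -/(hnorm _) -ltr_sqr ?nnegrE ?hnorm_ge0 ?ltW //.
  by rewrite hnormE; apply: le_lt_trans (rdot_le_fdot w (vB m k)) (NP m k Nm Nk).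
have vf e : 0 < e -> exists N, forall m, (N <= m)%N ->
    forall L, psum L (sq (v m - f)) <= e.
  move=> e0; have [|N NP] := uC (e / 4); first by lra.
  exists N => m Nm L.
  have [|M MP] := psum_pointwise_lim L fP (e := e / 4); first by lra.
  (* At this index [v k] is close to [v m] in norm and close to [f] on words shorter than [L]. It
     depends on [L], but the resulting bound does not. *)
  pose k := maxn N M.
  have h1 := MP k (leq_maxr _ _).
  have h2 := le_lt_trans (psum_le_fdot L (vB m k)) (NP m k Nm (leq_maxl _ _)).
  apply: (@le_trans _ _ (psum L (fun w => 2 * sq (v m - v k) w + 2 * sq (v k - f) w))).
    apply: le_psum => w; apply: le_trans (rdot_add_sq _ _).
    by rewrite /= !fctE subrKA.
  rewrite /psum big_split -!mulr_sumr; move: h1 h2; rewrite /psum /=; lra.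
have fl : l2 f.
  have [N NP] := vf 1 ltr01.
  have h : l2 (v N - f) by apply/l2P; exists 1; exact: NP.
  have -> : f = (-1) *: (v N - f) + v N by rewrite scaleN1r opprB subrK.
  exact: l2_lin.
exists (L2Of (introT (l2_predP f) fl)) => e e0 /=.
(* The bound in [vf] is not strict and concerns squared norms, hence the square of half of [e]. *)
have [|N NP] := vf ((e / 2) ^+ 2); first by rewrite exprn_gt0 // divr_gt0.
exists N => m Nm; have vfl : l2 (v m - f).
  by apply/l2P; exists ((e / 2) ^+ 2); exact: NP.
have : fdot (v m - f) (v m - f) <= (e / 2) ^+ 2.
  apply: ssum_to_le (NP m Nm) (ssum_to_fdot vfl vfl).
rewrite -/(v m) => h.
apply: (@le_lt_trans _ _ (e / 2)); last by lra.
rewrite -[leRHS](@ger0_norm _ (e / 2)); last by lra.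
by rewrite -sqrtr_sqr; apply: ler_wsqrtr.
Qed.

Definition L2 : hilbert R := Hilbert l2_dot_linl l2_dot_conj l2_dot_pos l2_complete.

Definition l2v (f : L2) : fock n K := l2_val f.

Lemma l2v_l2 (f : L2) : l2 (l2v f). Proof. exact: l2_valP. Qed.

Lemma l2v_inj : injective l2v.
Proof. by move=> f g e; apply: val_inj. Qed.

Lemma l2v_onto f : l2 f -> exists g : L2, l2v g = f.
Proof. by move=> fl; exists (L2Of (introT (l2_predP f) fl)). Qed.

Lemma l2v_lin a (f g : L2) : l2v (a *: f + g) = a *: l2v f + l2v g.
Proof. by []. Qed.

Lemma l2v_ssum (f g : L2) : ssum_to (fun w => rdot (l2v f w) (l2v g w)) (rdot f g).
Proof. exact: ssum_to_fdot (l2v_l2 f) (l2v_l2 g). Qed.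

Lemma psum_le_rdot N (f : L2) : psum N (sq (l2v f)) <= rdot f f.
Proof. exact (psum_le_fdot N (l2v_l2 f)). Qed.

Lemma fnorm_l2v (f : L2) : fnorm (l2v f) = hnorm f.
Proof. by rewrite /hnorm /= (fdotff (l2v_l2 f)). Qed.

End SquareSummable.

Arguments l2v_ssum {R n K} f g.

(** * Shifts on the Fock space *)

Section FockOperators.
Variables (R : realType) (n : nat) (K : hilbert R).
Implicit Types f g : fock n K.

Local Notation I := (Complex 0 1 : R[i]).
Local Notation sq f := (fun w => rdot (f w) (f w)).

(** The adjoint of [shift i]; see [hdot_shiftL]. *)
Definition bshift (i : 'I_n) f : fock n K := fun w => f (i :: w).

Lemma bshift_shift (i j : 'I_n) f : bshift j (shift i f) = if j == i then f else 0.
Proof. by apply/funext => w; rewrite /bshift /=; case: (j == i). Qed.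

Lemma l2_bshift i f : l2 f -> l2 (bshift i f).
Proof.
move=> /l2P[C fC]; apply/l2P; exists C => N; apply: le_trans (fC N.+1).
rewrite psumS (bigD1 i) //= addrCA lerDl addr_ge0 ?rdot_ge0 //.
by apply: sumr_ge0 => j _; apply: psum_ge0 => w; exact: rdot_ge0.
Qed.

Lemma l2_recl f : (forall i, l2 (bshift i f)) -> l2 f.
Proof.
move=> h; have /choice[C CP] := fun i => (l2P _).1 (h i).
apply/l2P; exists (rdot (f [::]) (f [::]) + \sum_i C i) => N.
have fN : psum N (sq f) <= psum N.+1 (sq f).
  by apply: (psum_mono (u := sq f)) => // w; exact: rdot_ge0.
apply: le_trans fN _; rewrite psumS lerD2l; apply: ler_sum => i _; exact: CP.
Qed.

Lemma l2_vac (x : K) : l2 (vac x : fock n K).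
Proof. by apply: l2_recl => i; exact: l2_0. Qed.

Lemma l2_shift i f : l2 f -> l2 (shift i f).
Proof.
move=> fl; apply: l2_recl => j; rewrite bshift_shift.
by case: (j == i) => //; exact: l2_0.
Qed.

Definition mkL2 f (fl : l2 f) : L2 n K := L2Of (introT (l2_predP f) fl).

Lemma l2v_mkL2 f (fl : l2 f) : l2v (mkL2 fl) = f. Proof. by []. Qed.

Definition vacL (x : K) : L2 n K := mkL2 (l2_vac x).
Definition shiftL i (f : L2 n K) : L2 n K := mkL2 (l2_shift i (l2v_l2 f)).
Definition bshiftL i (f : L2 n K) : L2 n K := mkL2 (l2_bshift i (l2v_l2 f)).

Lemma L2P (f g : L2 n K) : (forall w, l2v f w = l2v g w) -> f = g.
Proof. by move=> h; apply: l2v_inj; apply/funext. Qed.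

Lemma l2v_sum (T : Type) (s : seq T) (F : T -> L2 n K) w :
  l2v (\sum_(i <- s) F i) w = \sum_(i <- s) l2v (F i) w.
Proof. exact: (big_morph (fun f : L2 n K => l2v f w)). Qed.

Lemma vacL_linear : linear_map vacL.
Proof.
move=> a x y; apply: L2P => -[|i w] //.
by rewrite l2v_lin /= !fctE /= /vac /= scaler0 addr0.
Qed.

Lemma shiftL_linear i : linear_map (shiftL i).
Proof.
move=> a f g; apply: L2P => -[|j w]; rewrite l2v_lin /= !fctE /=.
  by rewrite scaler0 addr0.
by case: (j == i); rewrite ?scaler0 ?addr0.
Qed.

Lemma bshiftL_linear i : linear_map (bshiftL i).
Proof. by move=> a f g; apply: L2P. Qed.

Lemma bshiftL_shiftL i j (f : L2 n K) : bshiftL j (shiftL i f) = if j == i then f else 0.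
Proof. by apply: l2v_inj; rewrite /= bshift_shift; case: eqP. Qed.

Lemma bshiftL_vacL i x : bshiftL i (vacL x) = 0.
Proof. exact: L2P. Qed.

(** A word is either empty or has a first letter, so the vacuum projection and the projections
    [S_i S_i^*] add up to the identity. *)
Lemma L2_split (f : L2 n K) : f = vacL (l2v f [::]) + \sum_i shiftL i (bshiftL i f).
Proof.
apply: L2P => -[|j w].
  have -> : l2v (vacL (l2v f [::]) + \sum_i shiftL i (bshiftL i f)) [::] =
    l2v f [::] + l2v (\sum_i shiftL i (bshiftL i f)) [::] by [].
  by rewrite l2v_sum big1 ?addr0.
have -> : l2v (vacL (l2v f [::]) + \sum_i shiftL i (bshiftL i f)) (j :: w) =
    0 + l2v (\sum_i shiftL i (bshiftL i f)) (j :: w) by [].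
rewrite l2v_sum add0r (bigD1 j) //= eqxx big1 ?addr0 // => i.
by rewrite eq_sym => /negbTE ->.
Qed.

Lemma sum_shiftL_nil (F : 'I_n -> L2 n K) : l2v (\sum_i shiftL i (F i)) [::] = 0.
Proof. by rewrite l2v_sum big1. Qed.

Lemma bshiftL_sum_shiftL j (F : 'I_n -> L2 n K) : bshiftL j (\sum_i shiftL i (F i)) = F j.
Proof.
rewrite (linear_map_sum (bshiftL_linear j)) (bigD1 j) //= bshiftL_shiftL eqxx big1 ?addr0 //.
by move=> i; rewrite eq_sym bshiftL_shiftL => /negbTE ->.
Qed.

Lemma rdot_recl (f g : L2 n K) :
  rdot f g = rdot (l2v f [::]) (l2v g [::]) + \sum_i rdot (bshiftL i f) (bshiftL i g).
Proof.
apply: (ssum_to_unique (l2v_ssum f g)).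
exact: (ssum_to_recl (u := fun w => rdot (l2v f w) (l2v g w))
  (fun i => l2v_ssum (bshiftL i f) (bshiftL i g))).
Qed.

Lemma rdot_shiftL i (f g : L2 n K) : rdot (shiftL i f) g = rdot f (bshiftL i g).
Proof.
rewrite rdot_recl rdot0l add0r (bigD1 i) //= bshiftL_shiftL eqxx big1 ?addr0 //.
by move=> j /negbTE ji; rewrite bshiftL_shiftL ji rdot0l.
Qed.

Lemma hdot_shiftL i (f g : L2 n K) : hdot (shiftL i f) g = hdot f (bshiftL i g).
Proof. by rewrite hdotE -(linear_mapZ (shiftL_linear i)) !rdot_shiftL -hdotE. Qed.

Lemma hnorm_shiftL i (f : L2 n K) : hnorm (shiftL i f) = hnorm f.
Proof. by rewrite /hnorm -!/(rdot _ _) rdot_shiftL bshiftL_shiftL eqxx. Qed.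

Lemma hnorm_vacL x : hnorm (vacL x) = hnorm x.
Proof.
rewrite /hnorm -!/(rdot _ _) rdot_recl big1 ?addr0 // => i _.
by rewrite bshiftL_vacL rdot0l.
Qed.

Lemma hnorm_bshiftL_le i (f : L2 n K) : hnorm (bshiftL i f) <= hnorm f.
Proof.
apply: ler_wsqrtr; rewrite -!/(rdot _ _) [leRHS]rdot_recl (bigD1 i) //= addrCA.
by rewrite lerDl addr_ge0 ?rdot_ge0 // sumr_ge0 // => j _; exact: rdot_ge0.
Qed.

Lemma hnorm_nil_le (f : L2 n K) : hnorm (l2v f [::]) <= hnorm f.
Proof.
apply: ler_wsqrtr; rewrite -!/(rdot _ _) [leRHS]rdot_recl.
by rewrite lerDl sumr_ge0 // => j _; exact: rdot_ge0.
Qed.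

(* Keeps the components at the words of length < N. *)
Fixpoint truncL N (f : L2 n K) : L2 n K :=
  if N is N'.+1 then vacL (l2v f [::]) + \sum_i shiftL i (truncL N' (bshiftL i f)) else 0.

Lemma truncL_nil N (f : L2 n K) : l2v (truncL N.+1 f) [::] = l2v f [::].
Proof.
have -> : l2v (truncL N.+1 f) [::] =
    l2v f [::] + l2v (\sum_i shiftL i (truncL N (bshiftL i f))) [::] by [].
by rewrite sum_shiftL_nil addr0.
Qed.

Lemma bshiftL_truncL N i (f : L2 n K) : bshiftL i (truncL N.+1 f) = truncL N (bshiftL i f).
Proof. by rewrite /= (linear_mapD (bshiftL_linear i)) bshiftL_vacL add0r bshiftL_sum_shiftL. Qed.

Lemma rdot_truncL N (f : L2 n K) : rdot (truncL N f) (truncL N f) = psum N (sq (l2v f)).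
Proof.
elim: N f => [|N IHN] f; first by rewrite rdot0l /psum big_nil.
rewrite rdot_recl psumS truncL_nil; congr (_ + _).
by apply: eq_bigr => i _; rewrite bshiftL_truncL IHN.
Qed.

(** Pythagoras for the kept part and the remainder, obtained one letter at a time. *)
Lemma rdot_sub_truncL N (f : L2 n K) :
  rdot (f - truncL N f) (f - truncL N f) = rdot f f - psum N (sq (l2v f)).
Proof.
elim: N f => [|N IHN] f; first by rewrite subr0 /psum big_nil subr0.
rewrite psumS !rdot_recl.
have -> : l2v (f - truncL N.+1 f) [::] = l2v f [::] - l2v (truncL N.+1 f) [::] by [].
have cancel (a b c : R) : a + b - (a + c) = b - c by ring.
rewrite truncL_nil subrr rdot0l add0r cancel -sumrB.
apply: eq_bigr => i _.
by rewrite (linear_mapB (bshiftL_linear i)) bshiftL_truncL IHN.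
Qed.

Lemma truncL_cvg (f : L2 n K) (e : R) : 0 < e -> exists N, hnorm (f - truncL N f) < e.
Proof.
move=> e0; have e20 : 0 < e ^+ 2 by rewrite exprn_gt0.
have := l2v_ssum f f => /cvgrPdist_lt /(_ _ e20)[N _ NP].
exists N; rewrite -ltr_sqr ?nnegrE ?hnorm_ge0 ?ltW // hnormE rdot_sub_truncL.
by apply: le_lt_trans (ler_norm _) _; apply: NP => /=.
Qed.

Definition shiftwL (alpha : word n) (f : L2 n K) : L2 n K := foldr shiftL f alpha.

Lemma l2v_shiftwL alpha (f : L2 n K) : l2v (shiftwL alpha f) = shiftw alpha (l2v f).
Proof. by elim: alpha => //= i alpha <-. Qed.

Lemma shiftwL_linear alpha : linear_map (shiftwL alpha).
Proof. by move=> a f g; elim: alpha => //= i alpha ->; exact: shiftL_linear. Qed.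

End FockOperators.

Section ShiftCommuting.
Variables (R : realType) (n : nat) (K K' : hilbert R).

Definition shift_commuting (M : L2 n K -> L2 n K') :=
  forall i f, M (shiftL i f) = shiftL i (M f).

Lemma shift_commuting_shiftwL M alpha f : shift_commuting M ->
  M (shiftwL alpha f) = shiftwL alpha (M f).
Proof. by move=> MS; elim: alpha => //= i alpha <-; exact: MS. Qed.

End ShiftCommuting.

(** * Shift-invariant subspaces *)

Section Beurling.
Variables (R : realType) (n : nat) (K : hilbert R) (C : csubspace (L2 n K)).
Hypothesis C_shift : forall i f, C f -> C (shiftL i f).

Local Notation sq f := (fun w => rdot (f w) (f w)).

(* This is S_1 C + ... + S_n C; describing it by backward shifts makes its
   closedness immediate. *)
Definition in_shifted (g : L2 n K) := l2v g [::] = 0 /\ forall i, C (bshiftL i g).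

Lemma in_shifted0 : in_shifted 0.
Proof.
by split => // i; rewrite (linear_map0 (@bshiftL_linear R n K i)); exact: csub0.
Qed.

Lemma in_shifted_lin a x y : in_shifted x -> in_shifted y -> in_shifted (a *: x + y).
Proof.
move=> [x0 Cx] [y0 Cy]; split.
  by rewrite l2v_lin !fctE /= x0 y0 scaler0 addr0.
by move=> i; rewrite bshiftL_linear; exact: csub_lin.
Qed.

Lemma in_shifted_closed x :
  (forall e : R, 0 < e -> exists2 y, in_shifted y & hnorm (x - y) < e) ->
  in_shifted x.
Proof.
move=> h; split.
  apply: hnorm_eq0; apply/eqP; rewrite eq_le hnorm_ge0 andbT.
  apply/ler_addgt0Pr => e /h[y [y0 _] xy]; rewrite add0r.
  apply: le_trans (ltW xy).
  have -> : l2v x [::] = l2v (x - y) [::].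
    have -> : l2v (x - y) [::] = l2v x [::] - l2v y [::] by [].
    by rewrite y0 subr0.
  exact: hnorm_nil_le.
move=> i; apply: csub_closed => e /h[y [_ Cy] xy]; exists (bshiftL i y) => //.
rewrite -(linear_mapB (@bshiftL_linear R n K i)).
exact: le_lt_trans (hnorm_bshiftL_le _ _) xy.
Qed.

Definition csub_shifted := CSubspace in_shifted0 in_shifted_lin in_shifted_closed.

Lemma csub_shifted_sub x : csub_shifted x -> C x.
Proof.
move=> [x0 Cx]; rewrite (L2_split x) x0 (linear_map0 (@vacL_linear R n K)) add0r.
by apply: csub_sum => i; exact: C_shift.
Qed.

Definition wandering := csub_hilbert (csub_ortho C csub_shifted).
Local Notation W := wandering.

Definition incl (x : W) : L2 n K := csub_incl x.

Lemma incl_in x : C (incl x). Proof. by case: (csub_inclP x). Qed.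

Lemma incl_ortho x y : csub_shifted y -> hdot (incl x) y = 0.
Proof. by case: (csub_inclP x) => _; apply. Qed.

(** The part of [g] orthogonal to the shifted subspace is itself a wandering vector, so being
    orthogonal to all of these makes it vanish. *)
Lemma shifted_of_ortho g : C g -> (forall x : W, hdot g (incl x) = 0) ->
  csub_shifted g.
Proof.
move=> Cg gW; have [p pS pP] := projection csub_shifted g.
have [x xE] : exists x : W, incl x = g - p.
  apply: csub_incl_onto; split; last exact: pP.
  by apply: csubB => //; exact: csub_shifted_sub.
suff -> : g = p by [].
apply/eqP; rewrite -subr_eq0; apply/eqP/rdot_eq0.
have h1 : rdot g (incl x) = 0 by rewrite /rdot gW.
have h2 : rdot (incl x) p = 0 by rewrite /rdot incl_ortho.
by rewrite -{2}xE rdotDl rdotNl h1 (rdotC p) h2 subr0.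
Qed.

(* (chi f)(w) is the sum of (f u)(v) over the factorizations w = uv. *)
Fixpoint chi_fun (w : word n) (f : fock n W) : K :=
  if w is i :: w' then l2v (incl (f [::])) (i :: w') + chi_fun w' (bshift i f)
  else l2v (incl (f [::])) [::].

Definition chi (f : fock n W) : fock n K := fun w => chi_fun w f.

Lemma chi_fun_cons i w f :
  chi_fun (i :: w) f = l2v (incl (f [::])) (i :: w) + chi_fun w (bshift i f).
Proof. by []. Qed.

Lemma chi_fun0 w : chi_fun w 0 = 0.
Proof.
have incl0 v : l2v (incl 0) v = 0 by [].
elim: w => [|i w IHw]; first exact: incl0.
rewrite chi_fun_cons; have -> : bshift i (0 : fock n W) = 0 by [].
by rewrite IHw addr0; exact: incl0.
Qed.

Lemma chi_lin a f g : chi (a *: f + g) = a *: chi f + chi g.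
Proof.
have inclE (p q : fock n W) u w : l2v (incl ((a *: p + q) u)) w =
  a *: l2v (incl (p u)) w + l2v (incl (q u)) w by [].
apply/funext => w; change (chi_fun w (a *: f + g) = a *: chi_fun w f + chi_fun w g).
elim: w f g => [|i w IHw] f g; first exact: inclE.
rewrite !chi_fun_cons; have -> : bshift i (a *: f + g) = a *: bshift i f + bshift i g by [].
by rewrite IHw inclE scalerDr addrACA.
Qed.

Lemma chi_shift i f : chi (shift i f) = shift i (chi f).
Proof.
have incl0 w : l2v (incl 0) w = 0 by [].
apply/funext => -[|j w]; first exact: incl0.
rewrite [LHS]chi_fun_cons [shift i f [::]]/= incl0 add0r bshift_shift /=.
by case: (j == i) => //; exact: chi_fun0.
Qed.

(** The image under [chi] of [truncL N f], built inside [L2] so that its norm is available before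
    [chi] is known to preserve square-summability. *)
Fixpoint chi_trunc N (f : L2 n W) : L2 n K :=
  if N is N'.+1 then
    incl (l2v f [::]) + \sum_i shiftL i (chi_trunc N' (bshiftL i f))
  else 0.

(** The wandering term is orthogonal to the shifted terms, so squared norms add up. Membership in
    [C] is proved along with it because this orthogonality relies on it. *)
Lemma chi_truncP N f : C (chi_trunc N f) /\
  rdot (chi_trunc N f) (chi_trunc N f) = psum N (sq (l2v f)).
Proof.
elim: N f => [|N IHN] f; first by rewrite rdot0l /psum big_nil; split=> //; exact: csub0.
rewrite /=; set Y : L2 n K := \sum_i _.
have YS : csub_shifted Y.
  split; first exact: sum_shiftL_nil.
  by move=> i; rewrite bshiftL_sum_shiftL; case: (IHN (bshiftL i f)).
split; first by apply: csubD; [exact: incl_in|exact: csub_shifted_sub].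
have xY : rdot (incl (l2v f [::])) Y = 0 by rewrite /rdot incl_ortho.
rewrite !rdotDl !rdotDr (rdotC Y (incl _)) xY addr0 add0r psumS; congr (_ + _).
rewrite rdot_recl sum_shiftL_nil rdot0l add0r; apply: eq_bigr => i _.
by rewrite bshiftL_sum_shiftL; case: (IHN (bshiftL i f)).
Qed.

(** The value of [chi] at [w] involves only the components at prefixes of [w]. *)
Lemma chi_chi_trunc N f w : (size w < N)%N -> chi (l2v f) w = l2v (chi_trunc N f) w.
Proof.
elim: N f w => // N IHN f w wN.
have -> : l2v (chi_trunc N.+1 f) w =
  l2v (incl (l2v f [::])) w + l2v (\sum_i shiftL i (chi_trunc N (bshiftL i f))) w by [].
case: w wN => [|i w] wN; first by rewrite sum_shiftL_nil addr0.
rewrite /chi chi_fun_cons; congr (_ + _).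
have -> : l2v (\sum_i shiftL i (chi_trunc N (bshiftL i f))) (i :: w) =
  l2v (bshiftL i (\sum_i shiftL i (chi_trunc N (bshiftL i f)))) w by [].
by rewrite bshiftL_sum_shiftL -IHN.
Qed.

Lemma psum_chi N (f : L2 n W) : psum N (sq (chi (l2v f))) <= rdot f f.
Proof.
have -> : psum N (sq (chi (l2v f))) = psum N (sq (l2v (chi_trunc N f))).
  rewrite /psum big_seq [RHS]big_seq; apply: eq_bigr => w.
  by rewrite mem_words => /chi_chi_trunc ->.
apply: le_trans (psum_le_rdot N (chi_trunc N f)) _.
by have [_ ->] := chi_truncP N f; exact: psum_le_rdot.
Qed.

Lemma l2_chi (f : L2 n W) : l2 (chi (l2v f)).
Proof. by apply/l2P; exists (rdot f f) => N; exact: psum_chi. Qed.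

Definition chiL (f : L2 n W) : L2 n K := mkL2 (l2_chi f).

Lemma chiL_linear : linear_map chiL.
Proof. by move=> a f g; apply: l2v_inj; exact: chi_lin. Qed.

Lemma chiL_shift : shift_commuting chiL.
Proof. by move=> i f; apply: l2v_inj; exact: chi_shift. Qed.

Lemma chiL_vacL x : chiL (vacL n x) = incl x.
Proof.
apply: L2P => w; change (chi (vac x) w = l2v (incl x) w).
case: w => [|i w] //; rewrite /chi chi_fun_cons.
have -> : bshift i (vac x) = 0 :> fock n W by [].
by rewrite chi_fun0 addr0.
Qed.

Lemma chiL_truncL N f : chiL (truncL N f) = chi_trunc N f.
Proof.
elim: N f => [|N IHN] f /=; first exact: linear_map0 chiL_linear.
rewrite (linear_mapD chiL_linear) chiL_vacL (linear_map_sum chiL_linear).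
by congr (_ + _); apply: eq_bigr => i _; rewrite chiL_shift IHN.
Qed.

Lemma hnorm_chiL_le f : hnorm (chiL f) <= hnorm f.
Proof.
apply: ler_wsqrtr; rewrite -!/(rdot _ _).
by apply: (ssum_to_le _ (l2v_ssum (chiL f) (chiL f))) => N; exact: psum_chi.
Qed.

Lemma chiL_isometry f : hnorm (chiL f) = hnorm f.
Proof.
apply: (contraction_isometric_at chiL_linear hnorm_chiL_le) => e e0.
have [N NP] := truncL_cvg f e0; exists (truncL N f); split => //.
by rewrite /hnorm -!/(rdot _ _) chiL_truncL (chi_truncP N f).2 rdot_truncL.
Qed.

Lemma chiL_in f : C (chiL f).
Proof.
apply: csub_closed => e e0; have [N NP] := truncL_cvg f e0.
exists (chi_trunc N f); first by case: (chi_truncP N f).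
by rewrite -chiL_truncL -(linear_mapB chiL_linear) chiL_isometry.
Qed.

Lemma chiL_onto g : C g -> exists f, chiL f = g.
Proof.
have key w : forall g, C g -> (forall f, hdot g (chiL f) = 0) -> l2v g w = 0.
  elim: w => [|i w IHw] {}g Cg gP.
  - have [] // : csub_shifted g.
    by apply: shifted_of_ortho => // x; rewrite -chiL_vacL.
  - have [_ Ci] : csub_shifted g.
      by apply: shifted_of_ortho => // x; rewrite -chiL_vacL.
    (* By adjointness, orthogonality of [bshiftL i g] to [chiL f] is that of [g] to
       [chiL (shiftL i f)]. *)
    apply: (IHw (bshiftL i g)) => // f; apply: hdot_eq0C.
    by rewrite -hdot_shiftL -chiL_shift; exact: hdot_eq0C.
move=> Cg.
pose P y := exists f, chiL f = y.
have P0 : P 0 by exists 0; exact: linear_map0 chiL_linear.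
have PL a x y : P x -> P y -> P (a *: x + y).
  by move=> [f <-] [h <-]; exists (a *: f + h); exact: chiL_linear.
have PC y : (forall e : R, 0 < e -> exists2 z, P z & hnorm (y - z) < e) -> P y.
  move=> h; apply: (isometry_range_closed chiL_linear chiL_isometry) => e /h.
  by move=> [_ [f <-] ?]; exists f.
(* The range of [chiL] is closed; [key] annihilates what remains of [g] after projecting onto it. *)
have [p [f fp] pP] := projection (CSubspace P0 PL PC) g.
exists f; rewrite fp; apply/eqP; rewrite eq_sym -subr_eq0; apply/eqP/L2P => w.
apply: key => [|h]; last by apply: pP; exists h.
by apply: csubB => //; rewrite -fp; exact: chiL_in.
Qed.

End Beurling.

(** * Inner-outer factorization *)

Section Cyclic.
Variables (R : realType) (n : nat) (H K : hilbert R) (psi : H -> L2 n K).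
Hypothesis psiL : linear_map psi.

Definition orbit_sum (s : seq (word n * H)) : L2 n K :=
  \sum_(p <- s) shiftwL p.1 (psi p.2).

Definition in_orbit_span (g : L2 n K) := exists s, g = orbit_sum s.

Lemma in_orbit_span0 : in_orbit_span 0.
Proof. by exists [::]; rewrite /orbit_sum big_nil. Qed.

Lemma in_orbit_span_lin a x y :
  in_orbit_span x -> in_orbit_span y -> in_orbit_span (a *: x + y).
Proof.
move=> [s ->] [t ->]; exists ([seq (p.1, a *: p.2) | p <- s] ++ t).
(* Linearity of [psi] absorbs the scalar into the vectors of [H]. *)
rewrite /orbit_sum big_cat big_map scaler_sumr; congr (_ + _).
by apply: eq_bigr => p _; rewrite (linear_mapZ psiL) (linear_mapZ (@shiftwL_linear _ _ _ p.1)).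
Qed.

(** The smallest closed shift-invariant subspace containing the range of [psi]; a bounded [psi] is
    outer exactly when it is the whole space. *)
Definition cyclic_csub := csub_closure in_orbit_span0 in_orbit_span_lin.

(** Prefixing a letter to every word shifts an orbit sum, and shifts preserve distances. *)
Lemma cyclic_csub_shift i f : cyclic_csub f -> cyclic_csub (shiftL i f).
Proof.
move=> h e /h[_ [s ->] fs].
exists (orbit_sum [seq (i :: p.1, p.2) | p <- s]); first by eexists.
suff -> : orbit_sum [seq (i :: p.1, p.2) | p <- s] = shiftL i (orbit_sum s).
  by rewrite -(linear_mapB (@shiftL_linear _ _ _ i)) hnorm_shiftL.
by rewrite /orbit_sum big_map (linear_map_sum (@shiftL_linear _ _ _ i)).
Qed.

Lemma cyclic_csub_gen h : cyclic_csub (psi h).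
Proof.
by apply: in_closure_sub; exists [:: ([::], h)]; rewrite /orbit_sum big_seq1.
Qed.

End Cyclic.

Section RangeCyclic.
Variables (R : realType) (n : nat) (H K L : hilbert R).
Variables (psi : H -> L2 n K) (chi : L2 n K -> L2 n L) (theta : H -> L2 n L).
Hypotheses (psiL : linear_map psi) (chiL : linear_map chi) (thetaL : linear_map theta).
Hypotheses (chiN : forall f, hnorm (chi f) = hnorm f) (chiS : shift_commuting chi).
Hypothesis chi_psi : forall h, theta h = chi (psi h).

Lemma orbit_sum_image s : orbit_sum theta s = chi (orbit_sum psi s).
Proof.
rewrite /orbit_sum (linear_map_sum chiL); apply: eq_bigr => p _.
by rewrite chi_psi shift_commuting_shiftwL.
Qed.

(** Orbit sums of [psi] are carried to orbit sums of [theta]. The range of [chi] is thus determined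
    by [theta] alone, which is the source of uniqueness. *)
Lemma cyclic_image g :
  (forall f, cyclic_csub psiL f) ->
  cyclic_csub thetaL g <-> exists f, chi f = g.
Proof.
move=> psi_cyc; split => [gC|[f <-]].
  apply: (isometry_range_closed chiL chiN) => e /gC[_ [s ->] ?].
  by exists (orbit_sum psi s); rewrite -orbit_sum_image.
move=> e /(psi_cyc f)[_ [s ->] fs]; exists (orbit_sum theta s); first by eexists.
by rewrite orbit_sum_image -(linear_mapB chiL) chiN.
Qed.

(** Approximation of [chi f] by orbit sums of [theta] pulls back through the isometry; this makes
    the constructed [psi] outer. *)
Lemma cyclic_preimage :
  (forall f, cyclic_csub thetaL (chi f)) -> forall f, cyclic_csub psiL f.
Proof.
move=> h f e /(h f)[_ [s ->] fs]; exists (orbit_sum psi s); first by eexists.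
by rewrite -chiN (linear_mapB chiL) -orbit_sum_image.
Qed.

End RangeCyclic.

Section Factorization.
Variables (R : realType) (n : nat).

(** Serves both parts of the theorem, with [theta] the given operator in (i) and the symbol of
    M_theta in (ii). The witness [psiL] is listed because [cyclic_csub] takes it as an argument. *)
Lemma inner_outer_factorization (H K : hilbert R) (theta : H -> L2 n K)
    (thetaL : linear_map theta) :
  exists (W : hilbert R) (psi : H -> L2 n W) (chi : L2 n W -> L2 n K)
         (psiL : linear_map psi),
    [/\ linear_map chi, forall f, hnorm (chi f) = hnorm f, shift_commuting chi
      & (forall h, theta h = chi (psi h)) /\ forall f, cyclic_csub psiL f].
Proof.
pose C := cyclic_csub thetaL.
have CS : forall i f, C f -> C (shiftL i f) by exact: cyclic_csub_shift.
have cL := chiL_linear CS; have cN := chiL_isometry CS.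
have [|psi psiL psiE] := isometry_factor cL cN thetaL.
  by move=> h; apply: chiL_onto => //; exact: cyclic_csub_gen.
exists (wandering C), psi, (chiL CS), psiL; split => //.
  exact: chiL_shift.
split=> // ; apply: (cyclic_preimage _ cL (thetaL := thetaL) cN) => //.
  exact: chiL_shift.
by move=> f; exact: chiL_in.
Qed.

Lemma inner_range_unique (H H' K : hilbert R)
    (chi : L2 n H -> L2 n K) (chi' : L2 n H' -> L2 n K) :
  linear_map chi -> (forall f, hnorm (chi f) = hnorm f) -> shift_commuting chi ->
  linear_map chi' -> (forall f, hnorm (chi' f) = hnorm f) -> shift_commuting chi' ->
  (forall g, (exists f, chi f = g) <-> (exists f, chi' f = g)) ->
  exists (U : H -> H') (V : L2 n H -> L2 n H'),
    [/\ unitary U, forall f, chi f = chi' (V f)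
      & forall f, l2v (V f) = ampl U (l2v f)].
Proof.
move=> cL cN cS cL' cN' cS' rng.
have [|V VL' VE] := isometry_factor cL' cN' cL.
  by move=> f; apply/rng; exists f.
have VN f : hnorm (V f) = hnorm f by rewrite -cN' VE cN.
have inj' := isometry_inj cL' cN'.
have VS i f : V (shiftL i f) = shiftL i (V f) by apply: inj'; rewrite cS' !VE cS.
have Vonto g : exists f, V f = g.
  have [f fg] : exists f, chi f = chi' g by apply/rng; exists g.
  by exists f; apply: inj'; rewrite VE.
(* V (vacL x) is orthogonal to V (shiftL i f) = shiftL i (V f), so all its components
   except the vacuum one vanish. *)
have VV x : V (vacL n x) = vacL n (l2v (V (vacL n x)) [::]).
  rewrite {1}[V (vacL n x)]L2_split big1 ?addr0 // => i _.
  have -> : bshiftL i (V (vacL n x)) = 0; last exact: linear_map0 (@shiftL_linear _ _ _ i).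
  apply: rdot_eq0; have [f fE] := Vonto (bshiftL i (V (vacL n x))).
  rewrite -{1}fE -rdot_shiftL -VS (isometry_rdot VL' VN) rdot_shiftL bshiftL_vacL.
  by rewrite rdot0r.
pose U x := l2v (V (vacL n x)) [::].
have UL : linear_map U by move=> a x y; rewrite /U vacL_linear VL' l2v_lin.
have UN x : hnorm (U x) = hnorm x.
  by rewrite -(hnorm_vacL n) -VV VN hnorm_vacL.
exists U, V; split => //.
  split => // [x y|y]; first exact: isometry_hdot.
  have [f fE] := Vonto (vacL n y); exists (l2v f [::]).
  have : V (vacL n (l2v f [::])) = vacL n y; last by rewrite /U => ->.
  rewrite -fE {2}(L2_split f) (linear_mapD VL') (linear_map_sum VL') big1 ?addr0 //.
  move=> i _; suff -> : bshiftL i f = 0.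
    by rewrite (linear_map0 (@shiftL_linear _ _ _ i)) (linear_map0 VL').
  apply: rdot_eq0; rewrite -rdot_shiftL -(isometry_rdot VL' VN) VS fE rdot_shiftL bshiftL_vacL.
  exact: rdot0r.
(* After splitting [f] by first letters, only the vacuum part contributes at the empty word, and [V]
   commutes with backward shifts. *)
move=> f; apply/funext => w; rewrite /ampl; elim: w f => [|i w IHw] f.
  rewrite {1}(L2_split f) (linear_mapD VL') (linear_map_sum VL') VV.
  under eq_bigr => i _ do rewrite VS.
  have -> : l2v (vacL n (U (l2v f [::])) + \sum_i shiftL i (V (bshiftL i f))) [::] =
    U (l2v f [::]) + l2v (\sum_i shiftL i (V (bshiftL i f))) [::] by [].
  by rewrite sum_shiftL_nil addr0.
have <- : l2v (bshiftL i (V f)) w = l2v (V f) (i :: w) by [].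
rewrite {1}(L2_split f) (linear_mapD VL') (linear_map_sum VL') VV.
under eq_bigr => j _ do rewrite VS.
by rewrite (linear_mapD (@bshiftL_linear _ _ _ i)) bshiftL_vacL add0r bshiftL_sum_shiftL IHw.
Qed.

End Factorization.

(** * Passage between operators on families and operators on [L2] *)

Section Bundling.
Variables (R : realType) (n : nat).

Lemma bounded_to_fockP (H K : hilbert R) (psi : H -> fock n K) :
  bounded_to_fock psi <->
  exists2 T : H -> L2 n K, (forall h, psi h = l2v (T h)) &
    linear_map T /\ exists C : R, forall h, hnorm (T h) <= C * hnorm h.
Proof.
split=> [[psiL psil2 [C psiC]]|[T psiE [TL [C TC]]]].
  exists (fun h => mkL2 (psil2 h)) => //; split.
    by move=> a x y; apply: l2v_inj; rewrite l2v_lin; exact: psiL.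
  by exists C => h; rewrite -fnorm_l2v; exact: psiC.
split=> [a x y|h|]; first by rewrite !psiE TL.
  by rewrite psiE; exact: l2v_l2.
by exists C => h; rewrite psiE fnorm_l2v.
Qed.

Lemma outerP (H K : hilbert R) (psi : H -> fock n K) (T : H -> L2 n K)
    (TL : linear_map T) :
  (forall h, psi h = l2v (T h)) ->
  outer psi <-> (exists C : R, forall h, hnorm (T h) <= C * hnorm h) /\
                forall f, cyclic_csub TL f.
Proof.
move=> psiE.
have bE (f : L2 n K) s :
    fnorm (fadd (l2v f) (fopp (fun w => \sum_(p <- s) shiftw p.1 (psi p.2) w))) =
    hnorm (f - orbit_sum T s).
  rewrite -fnorm_l2v; congr fnorm; apply/funext => w.
  have -> : l2v (f - orbit_sum T s) w = l2v f w - l2v (orbit_sum T s) w by [].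
  rewrite /fadd /fopp /orbit_sum l2v_sum; congr (_ - _).
  by apply: eq_bigr => p _; rewrite psiE -l2v_shiftwL.
split=> [[[_ _ [C psiC]] dense]|[TC cyc]].
  split=> [|f e e0]; first by exists C => h; rewrite -fnorm_l2v -psiE.
  have [s] := dense _ (l2v_l2 f) e e0; rewrite bE => fs.
  by exists (orbit_sum T s) => //; exists s.
split; first by apply/bounded_to_fockP; exists T.
move=> f fl e e0; have [_ [s ->] fs] := cyc (mkL2 fl) e e0.
by exists s; rewrite -[f](l2v_mkL2 fl) bE.
Qed.

Lemma multi_analytic_lift (K K' : hilbert R) (M : fock n K -> fock n K') :
  multi_analytic M ->
  exists2 T : L2 n K -> L2 n K', (forall f, M (l2v f) = l2v (T f)) &
    [/\ linear_map T, shift_commuting T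
      & exists C : R, forall f, hnorm (T f) <= C * hnorm f].
Proof.
move=> [[ML Ml2 [C MC]] MS].
exists (fun f => mkL2 (Ml2 _ (l2v_l2 f))) => //; split.
- by move=> a f g; apply: l2v_inj; exact: (ML a _ _ (l2v_l2 f) (l2v_l2 g)).
- by move=> i f; apply: l2v_inj; exact: (MS i _ (l2v_l2 f)).
- by exists C => f; rewrite -!fnorm_l2v; exact: (MC _ (l2v_l2 f)).
Qed.

Lemma inner_lift (K K' : hilbert R) (M : fock n K -> fock n K') :
  inner M ->
  exists2 T : L2 n K -> L2 n K', (forall f, M (l2v f) = l2v (T f)) &
    [/\ linear_map T, forall f, hnorm (T f) = hnorm f & shift_commuting T].
Proof.
move=> [/multi_analytic_lift[T TE [TL TS _]] MN]; exists T => //; split=> // f.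
by rewrite -!fnorm_l2v -TE; exact: (MN _ (l2v_l2 f)).
Qed.

(* 0 is a junk value outside the square-summable families. *)
Definition on_fock (K K' : hilbert R) (T : L2 n K -> L2 n K') (f : fock n K) :
    fock n K' :=
  if pselect (l2 f) is left fl then l2v (T (mkL2 fl)) else 0.

Section OnFock.
Variables (K K' : hilbert R) (T : L2 n K -> L2 n K').

Lemma on_fock_l2v f : on_fock T (l2v f) = l2v (T f).
Proof.
rewrite /on_fock; case: pselect => [fl|/(_ (l2v_l2 f)) //].
by congr (l2v (T _)); exact: l2v_inj.
Qed.

Hypotheses (TL : linear_map T) (TS : shift_commuting T).

Lemma multi_analytic_on_fock :
  (exists C : R, forall f, hnorm (T f) <= C * hnorm f) ->
  multi_analytic (on_fock T).
Proof.
move=> [C TC]; split; last first.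
  move=> i _ /l2v_onto[f <-].
  by rewrite -[shift i (l2v f)]/(l2v (shiftL i f)) !on_fock_l2v TS.
split=> [a _ _ /l2v_onto[f <-] /l2v_onto[g <-]|_ /l2v_onto[f <-]|].
- by rewrite -[fadd _ _]/(l2v (a *: f + g)) !on_fock_l2v TL.
- by rewrite on_fock_l2v; exact: l2v_l2.
- by exists C => _ /l2v_onto[f <-]; rewrite on_fock_l2v !fnorm_l2v.
Qed.

Lemma inner_on_fock : (forall f, hnorm (T f) = hnorm f) -> inner (on_fock T).
Proof.
move=> TN; split=> [|_ /l2v_onto[f <-]]; last by rewrite on_fock_l2v !fnorm_l2v.
by apply: multi_analytic_on_fock; exists 1 => f; rewrite TN mul1r.
Qed.

End OnFock.

(** On truncations [T] is a sum of shifted values of its symbol; boundedness and density of the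
    truncations give the rest. *)
Lemma cyclic_csub_multi_analytic (K K' : hilbert R) (T : L2 n K -> L2 n K')
    (TVL : linear_map (T \o @vacL R n K)) :
  linear_map T -> shift_commuting T ->
  (exists C : R, forall f, hnorm (T f) <= C * hnorm f) ->
  forall f, cyclic_csub TVL (T f).
Proof.
move=> Tlin TS [C TC] f; apply: csub_closed => e e0.
(* A positive bound dominating [C], so that [e] can be divided by it. *)
have C0 : 0 < `|C| + 1 by rewrite ltr_wpDl.
have [|N fN] := truncL_cvg f (e := e / (`|C| + 1)); first by rewrite divr_gt0.
exists (T (truncL N f)).
  elim: N f {fN} => [|N IHN] f; first by rewrite (linear_map0 Tlin); exact: csub0.
  rewrite /= (linear_mapD Tlin) (linear_map_sum Tlin).
  apply: (csubD (C := cyclic_csub TVL)).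
    exact: (cyclic_csub_gen TVL).
  apply: (csub_sum (C := cyclic_csub TVL)) => i; rewrite TS.
  exact: cyclic_csub_shift.
rewrite -(linear_mapB Tlin); apply: le_lt_trans (TC _) _.
move: fN; rewrite ltr_pdivlMr // mulrC; apply: le_lt_trans.
apply: ler_wpM2r; first exact: hnorm_ge0.
by apply: le_trans (ler_norm _) _; rewrite lerDl.
Qed.

(** Both inner factors have the cyclic subspace of the common product as their range. *)
Lemma factorization_unique (H K W W' : hilbert R)
    (psi : H -> L2 n W) (chi : L2 n W -> L2 n K)
    (psi' : H -> L2 n W') (chi' : L2 n W' -> L2 n K)
    (psiL : linear_map psi) (psiL' : linear_map psi') :
  linear_map chi -> (forall f, hnorm (chi f) = hnorm f) -> shift_commuting chi ->
  linear_map chi' -> (forall f, hnorm (chi' f) = hnorm f) -> shift_commuting chi' ->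
  (forall f, cyclic_csub psiL f) -> (forall f, cyclic_csub psiL' f) ->
  (forall h, chi (psi h) = chi' (psi' h)) ->
  exists (U : W -> W') (V : L2 n W -> L2 n W'),
    [/\ unitary U, forall f, chi f = chi' (V f)
      & forall f, l2v (V f) = ampl U (l2v f)].
Proof.
move=> cL cN cS cL' cN' cS' cyc cyc' E.
have tL := linear_map_comp cL psiL.
apply: inner_range_unique => // g.
have h1 := @cyclic_image _ _ _ _ _ psi chi (chi \o psi) psiL cL tL cN cS (fun=> erefl) g cyc.
have h2 := @cyclic_image _ _ _ _ _ psi' chi' (chi \o psi) psiL' cL' tL cN' cS' E g cyc'.
exact: iff_trans (iff_sym h1) h2.
Qed.

End Bundling.

(** * Factorization and uniqueness for bounded and for multi-analytic operators *)

Theorem mainTheorem6 (R : realType) (n : nat) (hn : (1 <= n)%N) :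
  (* (i) *)
  (forall (H1 H2 : hilbert R) (theta : H1 -> fock n H2),
     findim H1 -> bounded_to_fock theta ->
     exists (H3 : hilbert R) (psi : H1 -> fock n H3)
            (chi : fock n H3 -> fock n H2),
       [/\ outer psi, inner chi, (forall h : H1, theta h = chi (psi h))
         & forall (H3' : hilbert R) (psi' : H1 -> fock n H3')
                  (chi' : fock n H3' -> fock n H2),
             outer psi' -> inner chi' -> (forall h : H1, theta h = chi' (psi' h)) ->
             exists U : H3 -> H3',
               [/\ unitary U,
                   (forall h : H1, psi' h = ampl U (psi h))
                 & forall f : fock n H3, l2 f -> chi f = chi' (ampl U f)]])
  /\
  (* (ii) *)
  (forall (H1 H2 : hilbert R) (theta : fock n H1 -> fock n H2),
     multi_analytic theta ->
     exists (H3 : hilbert R) (psi : fock n H1 -> fock n H3)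
            (chi : fock n H3 -> fock n H2),
       [/\ outer_ma psi, inner chi,
           (forall f : fock n H1, l2 f -> theta f = chi (psi f))
         & forall (H3' : hilbert R) (psi' : fock n H1 -> fock n H3')
                  (chi' : fock n H3' -> fock n H2),
             outer_ma psi' -> inner chi' ->
             (forall f : fock n H1, l2 f -> theta f = chi' (psi' f)) ->
             exists U : H3 -> H3',
               [/\ unitary U,
                   (forall f : fock n H1, l2 f -> psi' f = ampl U (psi f))
                 & forall f : fock n H3, l2 f -> chi f = chi' (ampl U f)]]).
Proof.
split=> [H1 H2 theta _ /bounded_to_fockP[T TE [TL [C TC]]]|H1 H2 theta].
  have [W [psi [chi [psiL [cL cN cS [E cyc]]]]]] := inner_outer_factorization TL.
  exists W, (fun h => l2v (psi h)), (on_fock chi); split.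
  - apply/(outerP psiL) => //; split=> //.
    (* As [chi] is isometric, [psi] inherits the bound of [theta]. *)
    by exists C => h; rewrite -cN -E.
  - exact: inner_on_fock.
  - by move=> h; rewrite on_fock_l2v -E.
  move=> W' psi' chi' op /inner_lift[c cE [cL' cN' cS']] E'.
  have [/bounded_to_fockP[p pE [pL _]] _] := op.
  have [_ pcyc] := (outerP pL pE).1 op.
  have pp h : chi (psi h) = c (p h).
    by apply: l2v_inj; rewrite -E -TE E' pE cE.
  have [U [V [UU VE VU]]] :=
    factorization_unique cL cN cS cL' cN' cS' cyc pcyc pp.
  exists U; split=> // [h|_ /l2v_onto[f <-]].
    rewrite pE -VU; congr l2v; apply: (isometry_inj cL' cN').
    by rewrite -pp VE.
  by rewrite on_fock_l2v -VU cE VE.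
move=> /multi_analytic_lift[T TE [TL TS [C TC]]].
have T0L := linear_map_comp TL (@vacL_linear R n H1).
have Tcyc : forall f, cyclic_csub T0L (T f).
  by apply: cyclic_csub_multi_analytic => //; exists C.
have [W [psi [chi [psiL [cL cN cS [E cyc]]]]]] := inner_outer_factorization T0L.
have cinj := isometry_inj cL cN.
(* The range of [T] lies in the cyclic subspace of its symbol, which is the range of [chi]. *)
have [|P PL PE] := isometry_factor cL cN TL.
  by move=> f; exact: (@cyclic_image _ _ _ _ _ _ _ _ psiL cL T0L cN cS E (T f) cyc).1.
have PS : shift_commuting P by move=> i f; apply: cinj; rewrite PE cS PE TS.
have PC f : hnorm (P f) <= C * hnorm f by rewrite -cN PE.
(* The symbol of [P] is [psi], which is already known to be cyclic. *)
have PV h : P (vacL n h) = psi h by apply: cinj; rewrite PE -E.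
exists W, (on_fock P), (on_fock chi); split.
- split; first by apply: multi_analytic_on_fock => //; exists C.
  apply/(outerP psiL) => [h|].
    by rewrite /symbol -[vac h]/(l2v (vacL n h)) on_fock_l2v PV.
  by split=> //; exists C => h; rewrite -PV -(hnorm_vacL n h).
- exact: inner_on_fock.
- by move=> _ /l2v_onto[f <-]; rewrite !on_fock_l2v PE TE.
move=> W' psi' chi' [/multi_analytic_lift[p pE [pL pS _]] op]
  /inner_lift[c cE [cL' cN' cS']] E'.
have p0L := linear_map_comp pL (@vacL_linear R n H1).
have [_ pcyc] := (outerP p0L (fun h => pE (vacL n h))).1 op.
have pp f : chi (P f) = c (p f).
  by apply: l2v_inj; rewrite PE -TE E' ?pE ?cE //; exact: l2v_l2.
(* Uniqueness is applied to the symbols; injectivity of [c] then extends the relation between the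
   outer factors to all families. *)
have [|U [V [UU VE VU]]] :=
  factorization_unique cL cN cS cL' cN' cS' cyc pcyc _.
  by move=> h; rewrite -PV pp.
exists U; split=> // _ /l2v_onto[f <-].
  rewrite pE on_fock_l2v -VU; congr l2v; apply: (isometry_inj cL' cN').
  by rewrite -pp VE.
by rewrite on_fock_l2v -VU cE VE.
Qed.
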